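(* Let $n\ge 2$ be an integer and $\boldsymbol{k}_1,\dots,\boldsymbol{k}_{n+1}$ indices, and let $\boldsymbol{z}_i\in\mathbb{D}^{\mathrm{dep}(\boldsymbol{k}_i)}$ for $1\le i\le n+1$; write $P_i=\left({\boldsymbol{z}_i\atop\boldsymbol{k}_i}\right)$. Let $v_1,\dots,v_n\in(\mathbb{D}\setminus\{0\})\cup\{\infty\}$ and $v_{n+1}\in\mathbb{D}$ satisfy \[ \frac{1}{v_1}+\cdots+\frac{1}{v_n}=v_{n+1}, \] and assume: (1) if $\boldsymbol{k}_i=\varnothing$ for some $1\le i\le n$, then $v_i\ne\infty$; (2) if $n=2$ and $\boldsymbol{k}_i=\varnothing$ for some $i\in\{1,2\}$, then $|v_{3-i}|\neq 1$ or $|v_3|<1$. (Here $1/\infty=0$ and $|\infty|=\infty$.) Then \[ \sum_{i=1}^{n+1}Z_n\left((P_1)_{\overset{v_1}{\longrightarrow}};\dots;P_i;\dots;(P_n)_{\overset{v_n}{\longrightarrow}} \ \middle| \ (P_{n+1})_{\overset{v_{n+1}}{\longrightarrow}}\right)=0, \] where in the $i$th term only the $i$th slot carries no arrow (for $i=n+1$ the term is $Z_n\left((P_1)_{\overset{v_1}{\longrightarrow}};\dots;(P_n)_{\overset{v_n}{\longrightarrow}}\ \middle|\ P_{n+1}\right)$).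
   Context: $\mathbb{D}=\{z\in\mathbb{C}:|z|\le1\}$, and $\mathbb{D}^0=\{\varnothing\}$. An index is a finite tuple $\boldsymbol{k}=(k_1,\dots,k_r)$ of positive integers ($r=\mathrm{dep}(\boldsymbol{k})$), possibly the empty tuple $\varnothing$. For $a_1,\dots,a_n\ge0$ put $C(a_1,\dots,a_n)=\frac{a_1!\cdots a_n!}{(a_1+\cdots+a_n)!}$. For indices $\boldsymbol{k}_j=(k^{(j)}_1,\dots,k^{(j)}_{r_j})$, $\boldsymbol{l}=(l_1,\dots,l_s)$ and $\boldsymbol{z}_j=(z^{(j)}_1,\dots,z^{(j)}_{r_j})\in\mathbb{D}^{r_j}$, $\boldsymbol{w}=(w_1,\dots,w_s)\in\mathbb{D}^s$, the multivariable connected sum is \[ Z_n\left({\boldsymbol{z}_1 \atop \boldsymbol{k}_1};\dots;{\boldsymbol{z}_n \atop \boldsymbol{k}_n} \ \middle| \ {\boldsymbol{w} \atop \boldsymbol{l}}\right)=\sum C(m^{(1)}_{r_1},\dots,m^{(n)}_{r_n})\left[\prod_{j=1}^n\prod_{i=1}^{r_j}\frac{(z^{(j)}_i)^{m^{(j)}_i-m^{(j)}_{i-1}}}{(m^{(j)}_i)^{k^{(j)}_i}}\right]\left[q_s\prod_{i=1}^s\frac{w_i^{q_i-q_{i-1}}}{q_i^{l_i}}\right], \] summed over all integers $0=m^{(j)}_0<m^{(j)}_1<\cdots<m^{(j)}_{r_j}$ ($1\le j\le n$) and $0=q_0<q_1\le\cdots\le q_s=m^{(1)}_{r_1}+\cdots+m^{(n)}_{r_n}$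 (so $m^{(j)}_{r_j}=0$ when $\boldsymbol{k}_j=\varnothing$). By convention $Z_n(\cdots\mid{\varnothing\atop\varnothing})=0$. Arrow notation: for an index $\boldsymbol{k}=(k_1,\dots,k_r)$ let $\boldsymbol{k}_{\to}=(k_1,\dots,k_r,1)$, $\boldsymbol{k}_{\uparrow}=(k_1,\dots,k_{r-1},k_r+1)$, with $\varnothing_{\to}=(1)$, $\varnothing_{\uparrow}=\varnothing$. For $v\in\mathbb{D}\setminus\{0\}$: $\left({\boldsymbol{z}\atop\boldsymbol{k}}\right)_{\overset{v}{\longrightarrow}}=\left({(\boldsymbol{z},v)\atop\boldsymbol{k}_{\to}}\right)$; $\left({\boldsymbol{z}\atop\boldsymbol{k}}\right)_{\overset{0}{\longrightarrow}}=\left({\boldsymbol{z}\atop\boldsymbol{k}}\right)_{\uparrow}=\left({\boldsymbol{z}\atop\boldsymbol{k}_\uparrow}\right)$; $\left({\boldsymbol{z}\atop\boldsymbol{k}}\right)_{\overset{\infty}{\longrightarrow}}=-\left({\boldsymbol{z}\atop\boldsymbol{k}_\uparrow}\right)$. Signs are pulled out: $Z_n(\epsilon_1P_1;\dots;\epsilon_nP_n\mid Q)=\epsilon_1\cdots\epsilon_n Z_n(P_1;\dots;P_n\mid Q)$ for $\epsilon_i\in\{\pm1\}$. *)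

(* Defs.v *)
From mathcomp Require Import all_boot all_order all_algebra complex.
From mathcomp Require Import all_classical all_reals all_analysis.
From mathcomp Require summability.

Set Implicit Arguments.
Unset Strict Implicit.
Unset Printing Implicit Defensive.
Import Order.TTheory GRing.Theory Num.Theory.
Import numFieldNormedType.Exports.
Local Open Scope classical_set_scope.
Local Open Scope ring_scope.
Local Open Scope complex_scope.

Section Summation.
Variables (R : realType) (I : choiceType).

Definition abs_summable (f : I -> R[i]) : Prop :=
  summable [set: I] (fun x => (Normc.normc (f x))%:E).

(* Unordered sum: the limit of the finite partial sums along the directed set
   of finite subsets of I. The alias R[i]^o carries the topology of the complex
   modulus. The value is meaningful only when this limit exists. *)
Definition unordered_sum (f : I -> R[i]) : R[i] :=
  summability.sum (f : I -> R[i]^o).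

End Summation.

Section ConnectedSum.
Variable R : realType.
Implicit Types (v w z : R[i]) (m q : seq nat).

(* The array (z_1, ..., z_r over k_1, ..., k_r) is the sequence of its columns
   (z_i, k_i); both the index k and the point z of D^r are empty for [::]. *)
Definition array := seq (R[i] * nat).
Implicit Types P Q : array.

Definition in_disk z : bool := `|z| <= 1.

Definition is_array P : bool := all (fun c => in_disk c.1 && (0 < c.2)%N) P.

Definition push v P : array := rcons P (v, 1%N).

Definition up P : array :=
  if P is c :: P' then
    rcons (belast c P') ((last c P').1, (last c P').2.+1)
  else [::].

Definition arrow v P : array := if v == 0 then up P else push v P.

(* A pair (b, P) stands for the formal expression (-1)^b P. *)
Definition signed_array : Type := bool * array.

(* In [option R[i]], [None] is the point at infinity. *)
Definition sarrow (v : option R[i]) P : signed_array :=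
  if v is Some c then (false, arrow c P) else (true, up P).

Definition inv_ext (v : option R[i]) : R[i] := if v is Some c then c^-1 else 0.

(* C(a_1, ..., a_n), the reciprocal of a multinomial coefficient. *)
Definition connector n (a : 'I_n -> nat) : R[i] :=
  (\prod_(j < n) (a j)`!)%N%:R / ((\sum_(j < n) a j)`!)%N%:R.

(* A chain m = [:: m_1; ...; m_r] does not store m_0 = 0: position i of
   [0 :: m] is m_i, whereas position i of P is the column of number i + 1. *)
Definition chain_prod P m : R[i] :=
  \prod_(i < size P)
    ((nth (0, 0%N) P i).1 ^+ (nth 0%N (0%N :: m) i.+1 - nth 0%N (0%N :: m) i)
     / (nth 0%N (0%N :: m) i.+1)%:R ^+ (nth (0, 0%N) P i).2).

Definition summation_index n : choiceType :=
  ({ffun 'I_n -> seq nat} * seq nat)%type.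

(* [path leq 1 q] is 0 < q_1 <= ... <= q_s; [last 0 _] is m_r, or 0 for the
   empty chain. *)
Definition admissible n (P : 'I_n -> array) Q (x : summation_index n) : bool :=
  [&& [forall j, (size (x.1 j) == size (P j)) && path ltn 0%N (x.1 j)],
      size x.2 == size Q, path leq 1%N x.2 &
      last 0%N x.2 == (\sum_(j < n) last 0%N (x.1 j))%N].

Definition Zterm n (P : 'I_n -> array) Q (x : summation_index n) : R[i] :=
  if admissible P Q x then
    connector (fun j => last 0%N (x.1 j))
    * (\prod_(j < n) chain_prod (P j) (x.1 j))
    * ((last 0%N x.2)%:R * chain_prod Q x.2)
  else 0.

Definition Z n (P : 'I_n -> array) Q : R[i] :=
  if Q is [::] then 0 else unordered_sum (Zterm P Q).

Definition Zsigned n (S : 'I_n -> signed_array) Q : R[i] :=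
  (\prod_(j < n) (-1) ^+ (S j).1) * Z (fun j => (S j).2) Q.

Definition Zconverges n (S : 'I_n -> signed_array) Q : Prop :=
  abs_summable (Zterm (fun j => (S j).2) Q).

(* Among the slots 0, ..., n (slot n being the one right of the bar), all but
   slot i carry their arrow. *)
Definition lower_slots n (P : 'I_n.+1 -> array) (v : 'I_n -> option R[i])
    (i : 'I_n.+1) (j : 'I_n) : signed_array :=
  let j' := widen_ord (leqnSn n) j in
  if j' == i then (false, P j') else sarrow (v j) (P j').

Definition upper_slot n (P : 'I_n.+1 -> array) (vlast : R[i])
    (i : 'I_n.+1) : array :=
  if i == ord_max then P ord_max else arrow vlast (P ord_max).

End ConnectedSum.

(* Main.v *)
(* Let f_j(a) be the sum of chain products of P_j over the chains ending at a,
   F_j(a) the signed sum for the array with arrow, and g, G the analogous sums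
   for the array right of the bar. With u_j = 1/v_j (and 1/oo = 0) the arrows
   amount to the first order recursions
     u_j (a+1) F_j(a+1) - a F_j(a) = f_j(a),
     (q+1) G(q+1) = v_{n+1} q G(q) + g(q+1)   (q > 0).
   For Phi_j = sum_a a! f_j(a) X^a and Psi_j = sum_a a! F_j(a) X^a the first one
   reads X Phi_j = u_j Psi_j - X^2 Psi_j', so that by the Leibniz rule
     sum_i Phi_i prod_(j <> i) Psi_j = (v_{n+1}/X - X d/dX) prod_j Psi_j.
   Comparing coefficients, the n+1 connected sums truncated at q <= N add up to
   the single term v_{n+1} [X^(N+1)](prod_j Psi_j) N G(N) / N!, by telescoping.
   Chain sums grow at most like powers of the harmonic numbers, and in the
   convolution powers of (a-1)! the extreme summands dominate; this gives
   absolute convergence and shows that the boundary term tends to 0. *)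
Require Import Defs.
From mathcomp Require Import all_boot all_order all_algebra complex finmap.
From mathcomp Require Import all_classical all_reals all_analysis.
From mathcomp Require Import ring zify.

Set Implicit Arguments.
Unset Strict Implicit.
Unset Printing Implicit Defensive.
Import Order.TTheory GRing.Theory Num.Theory.
Import numFieldNormedType.Exports.
Local Open Scope classical_set_scope.
Local Open Scope ring_scope.
Local Open Scope complex_scope.

#[local] Existing Instance summability.totally_filter.

(** * Elementary estimates: factorial convolutions, harmonic numbers, coefficients of products *)

(** Passing from [j] to [j + 1] multiplies the left side by [j + 1] and the right side by [k + j],
    which is no smaller because [k] is positive. *)
Lemma leq_fact_mul k j : (0 < k)%N -> (0 < j)%N -> (k`! * j`! <= (k + j).-1`!)%N.
Proof.
move=> k0; elim: j => [//|[|j] IH] _; first by rewrite addn1 muln1.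
rewrite factS mulnCA addnS /= -[X in (_ <= X`!)%N](prednK (n := k + j.+1)) ?addnS//.
by rewrite factS leq_mul //; [lia|rewrite -addnS; apply: IH].
Qed.

(** For positive [m] the two extreme summands are [m!] each. By [leq_fact_mul] each of the [m - 1]
    inner ones is at most [(m - 1)!], so that together they stay below a third [m!]. *)
Lemma leq_sum_fact_mul m : (\sum_(k < m.+1) k`! * (m - k)`! <= 3 * m`!)%N.
Proof.
case: m => [|m]; first by rewrite big_ord1.
rewrite big_ord_recr big_ord_recl /= subn0 subnn fact0 mul1n muln1.
set s := (X in (_ + X + _)%N); suff: (s <= m.+1`!)%N.
  move: s m.+1`! => s t; lia.
rewrite /s.
apply: (@leq_trans (\sum_(i < m) m`!)%N).
  apply: leq_sum => i _; rewrite /bump add1n subSS.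
  have := @leq_fact_mul i.+1 (m - i) isT; rewrite subn_gt0 ltn_ord => /(_ isT).
  by rewrite addSn /= subnKC // ltnW.
by rewrite sum_nat_const card_ord factS leq_mul.
Qed.

Section Bounds.
Variable K : numFieldType.

(** Majorant of a slot, up to powers of harmonic numbers: [a!] times a chain sum of order [1/a]. The
    factor [(0 < a)] removes the constant term, where [a.-1] would yield [0! = 1]. *)
Definition fact_poly M : {poly K} := \poly_(a < M) ((0 < a)%N%:R * (a.-1)`!%:R).

Lemma coef_fact_poly M q : (q < M)%N ->
  (fact_poly M)`_q = (0 < q)%N%:R * (q.-1)`!%:R.
Proof. by move=> qM; rewrite coef_poly qM. Qed.

Lemma coef0_fact_poly M n : (fact_poly M ^+ n.+1)`_0 = 0.
Proof. by rewrite exprS coef0M coef_poly ltnn mul0r if_same mul0r. Qed.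

(* The two extreme summands of the convolution of [k!] with itself dominate. *)
Lemma sum_fact_le q :
  \sum_(a < q.+1 | (0 < a < q)%N) ((a.-1)`! * (q - a).-1`!)%N%:R
    <= 6%:R * (q.-1)`!%:R / q%:R :> K.
Proof.
case: q => [|[|q]]; try by rewrite big1 ?mulr_ge0 ?invr_ge0 ?ler0n // => i; lia.
rewrite -natr_sum big_mkcond big_ord_recr big_ord_recl /= ltnn addn0 add0n.
rewrite (eq_bigr (fun i : 'I_q.+1 => (i`! * (q - i)`!)%N)) => [|i _]; last first.
  rewrite /bump add1n /= subSS ltnS ltn_ord.
  by rewrite (subSn (_ : (i <= q)%N)) //; have := ltn_ord i; rewrite ltnS.
rewrite ler_pdivlMr ?ltr0n // -!natrM ler_nat.
apply: (leq_trans (leq_mul (leq_sum_fact_mul q) (leqnn _))).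
rewrite factS; nia.
Qed.

(** Each further factor costs a constant 6 and gains [1/q] by [sum_fact_le]. The induction weakens
    [1/b] to 1 before the next convolution, so a single gain survives; it is what later makes the
    sums over [q] converge. *)
Lemma coef_fact_polyX_le M n q : (q < M)%N ->
  (fact_poly M ^+ n.+2)`_q <= (6 ^ n.+1)%N%:R * (q.-1)`!%:R / q%:R.
Proof.
have step m (c : K) r : 0 <= c -> (r < M)%N ->
    (forall b, (b < M)%N -> (fact_poly M ^+ m.+1)`_b <= c * (b.-1)`!%:R) ->
    (fact_poly M ^+ m.+2)`_r <= c * (6%:R * ((r.-1)`!%:R / r%:R)).
  move=> c0 rM IH; rewrite [6%:R * _]mulrA; apply: le_trans (ler_wpM2l c0 (sum_fact_le r)).
  rewrite exprS coefM mulr_sumr [leRHS]big_mkcond /=; apply: ler_sum => a _.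
  have aM : (a < M)%N by apply: leq_ltn_trans rM; rewrite -ltnS.
  rewrite (coef_fact_poly aM).
  case: posnP => [->|a0]; first by rewrite !mul0r.
  have [ar|ra] := ltnP a r; last first.
    by rewrite (eqP (_ : (r - a == 0)%N)) ?subn_eq0 // coef0_fact_poly mulr0.
  rewrite mul1r natrM mulrCA ler_wpM2l ?ler0n // IH //.
  by apply: leq_ltn_trans rM; apply: leq_subr.
elim: n q => [|n IH] q qM.
  rewrite expn1 -mulrA -[leRHS]mul1r; apply: step => // b bM.
  rewrite expr1 mul1r coef_fact_poly //; case: posnP => _; first by rewrite mul0r ler0n.
  by rewrite mul1r.
rewrite expnS mulnC natrM -!mulrA; apply: step => // b bM.
apply: le_trans (IH b bM) _; case: b {bM} => [|b].
  by rewrite invr0 mulr0 mulr_ge0 ?ler0n.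
by rewrite ler_pdivrMr ?ltr0n // ler_peMr ?mulr_ge0 ?ler0n // ler1n.
Qed.

(* harm m = 1 + H_m, so that harm is everywhere at least 1. *)
Definition harm m : K := 1 + \sum_(i < m) i.+1%:R^-1.

Lemma harmS m : harm m.+1 = harm m + m.+1%:R^-1.
Proof. by rewrite /harm big_ord_recr addrA. Qed.

Lemma harm_ge1 m : 1 <= harm m.
Proof. by rewrite lerDl sumr_ge0 // => i _; rewrite invr_ge0 ler0n. Qed.

Lemma harm_ge0 m : 0 <= harm m.
Proof. exact: le_trans ler01 (harm_ge1 m). Qed.

Lemma le_harm : {homo harm : a b / (a <= b)%N >-> a <= b}.
Proof.
apply: homo_leq => [//|y x z|m]; first exact: le_trans.
by rewrite harmS lerDl invr_ge0 ler0n.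
Qed.

Lemma le_harmX D E a b : (D <= E)%N -> (a <= b)%N -> harm a ^+ D <= harm b ^+ E.
Proof.
move=> DE ab; apply: le_trans (ler_weXn2l (harm_ge1 b) DE).
by rewrite lerXn2r ?nnegrE ?harm_ge0 // le_harm.
Qed.

(** Discrete form of the mean value theorem: in the factorisation of the difference of powers each
    of the [D + 1] monomials of the cofactor is at most [y ^+ D]. *)
Lemma expr_diff_le (x y : K) D : 0 <= x -> x <= y ->
  y ^+ D.+1 - x ^+ D.+1 <= D.+1%:R * (y - x) * y ^+ D.
Proof.
move=> x0 xy; have y0 := le_trans x0 xy.
rewrite subrXX -[leRHS]mulrA mulrCA; apply: ler_wpM2l.
  by rewrite subr_ge0.
rewrite mulr_natl -[X in _ *+ X]card_ord -sumr_const; apply: ler_sum => i _.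
have iD : (i <= D)%N by rewrite -ltnS.
rewrite /= -[in leRHS](subnK iD) exprD.
by rewrite ler_wpM2l ?exprn_ge0 // lerXn2r.
Qed.

Lemma inv_consecutive N :
  (N.+1%:R * N.+2%:R)^-1 = N.+1%:R^-1 - N.+2%:R^-1 :> K.
Proof.
have n1 : N.+1%:R != 0 :> K by rewrite pnatr_eq0.
have n2 : N.+2%:R != 0 :> K by rewrite pnatr_eq0.
apply: (mulfI (mulf_neq0 n1 n2)); rewrite mulfV ?mulf_neq0 //.
by rewrite mulrBr mulrAC mulfV // mul1r mulfK // -(natr1 N.+1) addrAC subrr add0r.
Qed.

(* Summation by parts, with 1/(q(q+1)) = 1/q - 1/(q+1); the induction is on D. *)
Lemma sum_harm_bounded D : exists2 M : K, 0 <= M & forall N,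
  \sum_(q < N) harm q.+1 ^+ D / (q.+1%:R * q.+2%:R) + harm N ^+ D / N.+1%:R <= M.
Proof.
elim: D => [|D [M M0 IH]].
  exists 1 => // N.
  suff -> : \sum_(q < N) harm q.+1 ^+ 0 / (q.+1%:R * q.+2%:R) = 1 - N.+1%:R^-1.
    by rewrite expr0 mul1r subrK.
  elim: N => [|N IH]; first by rewrite big_ord0 invr1 subrr.
  rewrite big_ord_recr /= {}IH expr0 div1r.
  by rewrite inv_consecutive addrA subrK.
(* The 1 is the left side at [N = 0]. Raising [N] adds the increment of [harm ^+ D.+1] divided by
   [N + 1], which [expr_diff_le] and [N + 2 <= 2 (N + 1)] bound by [2 (D + 1)] times the new summand
   of exponent [D]. *)
exists (1 + D.+1%:R * 2%:R * M); first by rewrite addr_ge0 ?mulr_ge0 ?ler0n.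
move=> N.
apply: (@le_trans _ _ (1 + D.+1%:R * 2%:R * \sum_(q < N) harm q.+1 ^+ D / (q.+1%:R * q.+2%:R))).
  elim: N => [|N IHN]; first by rewrite !big_ord0 add0r mulr0 addr0 divr1 /harm big_ord0 addr0 expr1n.
  rewrite !big_ord_recr /= [X in _ <= 1 + X]mulrDr [leRHS]addrA.
  have -> : forall s : K, s + harm N.+1 ^+ D.+1 / (N.+1%:R * N.+2%:R) + harm N.+1 ^+ D.+1 / N.+2%:R
    = (s + harm N ^+ D.+1 / N.+1%:R) + (harm N.+1 ^+ D.+1 - harm N ^+ D.+1) / N.+1%:R.
    by move=> s; rewrite inv_consecutive; ring.
  apply: lerD; first exact: IHN.
  have := expr_diff_le D (harm_ge0 N) (le_harm (leqnSn N)).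
  rewrite (_ : harm N.+1 - harm N = N.+1%:R^-1); last by rewrite harmS addrC addKr.
  move=> hd.
  rewrite ler_pdivrMr ?ltr0n //; apply: le_trans hd _.
  have -> (x y : K) : x * 2%:R * (y / (N.+1%:R * N.+2%:R)) * N.+1%:R
      = x * (2%:R / N.+2%:R) * y.
    have n1 : N.+1%:R != 0 :> K by rewrite pnatr_eq0.
    rewrite -!mulrA; congr (_ * (_ * _)).
    by rewrite invfM [_ * N.+1%:R]mulrAC mulVf // mul1r mulrC.
  rewrite ler_wpM2r ?exprn_ge0 ?harm_ge0 // ler_wpM2l ?ler0n //.
  rewrite ler_pdivlMr ?ltr0n // mulrC ler_pdivrMr ?ltr0n // -natrM ler_nat; lia.
rewrite lerD2l ler_wpM2l ?mulr_ge0 ?ler0n //.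
apply: le_trans (IH N); rewrite lerDl divr_ge0 ?exprn_ge0 ?harm_ge0 ?ler0n //.
Qed.

Lemma sum_harm_sqr_bounded D : exists2 M : K, 0 <= M & forall N,
  \sum_(q < N) harm q.+1 ^+ D / q.+1%:R ^+ 2 <= M.
Proof.
have [M M0 hM] := sum_harm_bounded D; exists (2%:R * M) => [|N].
  by rewrite mulr_ge0 ?ler0n.
apply: (@le_trans _ _ (2%:R * \sum_(q < N) harm q.+1 ^+ D / (q.+1%:R * q.+2%:R))).
  rewrite mulr_sumr ler_sum // => q _; rewrite mulrCA ler_wpM2l ?exprn_ge0 ?harm_ge0 //.
  rewrite -natrX -natrM ler_pdivlMr ?ltr0n ?muln_gt0 // mulrC ler_pdivrMr ?ltr0n ?expn_gt0 //.
  by rewrite -natrM ler_nat; nia.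
rewrite ler_wpM2l ?ler0n //; apply: le_trans (hM N).
by rewrite lerDl divr_ge0 ?exprn_ge0 ?harm_ge0 ?ler0n.
Qed.

(** Read off from the boundary term that [sum_harm_bounded] keeps beside the sum. *)
Lemma harmX_le D : exists2 M : K, 0 <= M & forall N, harm N ^+ D <= M * N.+1%:R.
Proof.
have [M M0 hM] := sum_harm_bounded D; exists M => // N.
rewrite -ler_pdivrMr ?ltr0n //; apply: le_trans (hM N).
by rewrite lerDr sumr_ge0 // => i _; rewrite divr_ge0 ?exprn_ge0 ?harm_ge0 -?natrM ?ler0n.
Qed.

(** A coefficient of degree [a] of a product involves only coefficients of degree at most [a]; hence
    domination up to degree [q] passes from the factors to the product. *)
Lemma coef_prod_le (I : finType) (p r : I -> {poly K}) q :
  (forall j a, (a <= q)%N -> `|(p j)`_a| <= (r j)`_a) ->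
  `|(\prod_j p j)`_q| <= (\prod_j r j)`_q.
Proof.
move=> pr; move: (leqnn q); move: {1 3 4}q.
apply: (big_ind2 (fun x y : {poly K} => forall a, (a <= q)%N -> `|x`_a| <= y`_a)).
- by move=> a _; rewrite coef1 normr_nat.
- move=> x1 x2 y1 y2 H1 H2 a aq; rewrite !coefM.
  apply: le_trans (ler_norm_sum _ _ _) _; apply: ler_sum => i _.
  rewrite normrM ler_pM ?normr_ge0 //; first exact/H1/(leq_trans (leq_ord i)).
  exact/H2/(leq_trans (leq_subr i a)).
by move=> j _ a aq; apply: pr.
Qed.

Lemma sum_geom_le (rho : K) m : 0 <= rho -> rho < 1 ->
  \sum_(k < m) k.+1%:R * rho ^+ k <= (1 - rho) ^- 2.
Proof.
move=> r0 r1; have s0 : 0 < 1 - rho by rewrite subr_gt0.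
have sn : 1 - rho != 0 by rewrite gt_eqF.
(* Closed form of the differentiated finite geometric sum; what it subtracts from 1 is
   nonnegative. *)
suff -> : \sum_(k < m) k.+1%:R * rho ^+ k =
  (1 - rho) ^- 2 * (1 - rho ^+ m * (m%:R * (1 - rho) + 1)).
  rewrite ler_piMr ?invr_ge0 ?exprn_ge0 ?(ltW s0) // gerBl.
  by rewrite mulr_ge0 ?exprn_ge0 // addr_ge0 // mulr_ge0 ?ler0n // ltW.
elim: m => [|m IH]; first by rewrite big_ord0 expr0 mul0r add0r mulr1 subrr mulr0.
rewrite big_ord_recr /= {}IH (exprS rho m) -(natr1 m); field; exact: sn.
Qed.

End Bounds.

(** * Finite enumeration of chains *)

(** No order is imposed on the letters: these words are a finite supply from which [path] selects
    the chains later. *)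
Fixpoint chains r N : seq (seq nat) :=
  if r is r'.+1 then [seq rcons m b | m <- chains r' N, b <- iota 0 N.+1]
  else [:: [::]].

Lemma mem_chains r N m :
  (m \in chains r N) = (size m == r) && all (fun b => (b <= N)%N) m.
Proof.
elim: r m => [|r IH] m; first by case: m.
apply/allpairsP/idP => [[[m' b] []]|].
  rewrite IH mem_iota /= => /andP[/eqP sm am] bN ->.
  by rewrite size_rcons sm eqxx all_rcons am andbT /=; lia.
case/lastP: m => [//|m b]; rewrite size_rcons all_rcons eqSS => /and3P[sm bN am].
by exists (m, b); rewrite IH sm am mem_iota.
Qed.

Lemma uniq_chains r N : uniq (chains r N).
Proof.
elim: r => [//|r IH]; apply: allpairs_uniq => //; first exact: iota_uniq.
by move=> [m b] [m' b'] _ _ /= /rcons_inj[-> ->].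
Qed.

(** The clause [0 < b] excludes [q_1 = 0], so that weak chains too are paths from 0, and strict and
    weak chains can share one generating function. *)
Definition weak_step : rel nat := fun a b => (a <= b)%N && (0 < b)%N.

Lemma path_weak_step m : path leq 1 m = path weak_step 0 m.
Proof.
case: m => [//|a m] /=; rewrite [weak_step 0 a]/weak_step leq0n /=; case: posnP => //= a0.
elim: m a a0 => [//|b m IH] a a0 /=; rewrite [weak_step a b]/weak_step.
by case: (leqP a b) => //= ab; rewrite (leq_trans a0 ab) -IH // (leq_trans a0 ab).
Qed.

(** * Generating functions of chain products, sorted by the last entry *)

Section GeneratingFunction.
Variable R : realType.
Local Notation C := R[i].
Implicit Types (P : array R) (e : rel nat).

Definition gf_step e (f : nat -> C) (c : C * nat) (b : nat) : C :=
  (\sum_(a < b.+1 | e a b) f a * c.1 ^+ (b - a)) / b%:R ^+ c.2.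

(* chain_gf e P b is the sum of chain_prod P m over the e-chains 0, m_1, ..., m_r
   with m_r = b. *)
Definition chain_gf e P : nat -> C := foldl (gf_step e) (fun b => (b == 0)%N%:R) P.

Lemma gf_rcons e P c b : chain_gf e (rcons P c) b = gf_step e (chain_gf e P) c b.
Proof. by rewrite /chain_gf foldl_rcons. Qed.

Lemma chain_prod_rcons P c m b : size m = size P ->
  chain_prod (rcons P c) (rcons m b) =
  chain_prod P m * (c.1 ^+ (b - last 0%N m) / b%:R ^+ c.2).
Proof.
move=> sm; rewrite /chain_prod size_rcons big_ord_recr /=; congr (_ * _).
  apply: eq_bigr => i _; rewrite !nth_rcons sm ltn_ord -!rcons_cons.
  by rewrite !nth_rcons /= sm ltnS ltnW.
rewrite !nth_rcons sm ltnn eqxx -rcons_cons nth_rcons /= sm ltnSn.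
by rewrite (last_nth 0%N) sm.
Qed.

Variables (e : rel nat) (he : forall a b, e a b -> weak_step a b).

(** Induction on the last column: with the last entry [b] fixed, sorting the shorter chains by their
    own last entry [a] gives one [gf_step]. The bound [N] loses nothing, since the entries of a
    chain do not exceed its last one. *)
Lemma sum_chains P N b : (b <= N)%N ->
  \sum_(m <- chains (size P) N | path e 0 m && (last 0%N m == b))
     chain_prod P m = chain_gf e P b.
Proof.
elim/last_ind: P b => [|P c IH] b bN.
  by rewrite big_mkcond big_seq1 /= /chain_gf /chain_prod /= big_ord0 [0%N == b]eq_sym; case: eqP.
rewrite size_rcons gf_rcons /gf_step big_mkcond big_allpairs_dep.
transitivity (\sum_(m <- chains (size P) N | path e 0 m && e (last 0%N m) b)
   chain_prod P m * (c.1 ^+ (b - last 0%N m) / b%:R ^+ c.2)).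
  rewrite [RHS]big_mkcond big_seq [RHS]big_seq; apply: eq_bigr => m.
  rewrite mem_chains => /andP[/eqP sm _].
  rewrite (bigD1_seq b) ?iota_uniq ?mem_iota // last_rcons eqxx andbT.
  rewrite rcons_path chain_prod_rcons // big1 /= ?addr0 // => b' /negbTE nb.
  by rewrite last_rcons nb andbF.
rewrite mulr_suml.
under [RHS]eq_bigr => a _ do rewrite -IH ?(leq_trans (leq_ord a)) // 2!mulr_suml.
rewrite (exchange_big_dep (fun m => path e 0 m && e (last 0%N m) b)) /=; last first.
  by move=> a m eab /andP[-> /eqP->].
apply: eq_bigr => m /andP[pm elb].
have lb : (last 0%N m < b.+1)%N by have := he elb; rewrite ltnS => /andP[].
rewrite (big_pred1 (Ordinal lb)) => [|a]; first by rewrite /= mulrA.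
rewrite pm /= eq_sym -val_eqE /=; case: eqP => [->|_]; rewrite ?elb ?andbF //.
Qed.

Lemma last_chain_le r N m : m \in chains r N -> (last 0%N m <= N)%N.
Proof.
rewrite mem_chains => /andP[_ /allP am].
by case/lastP: m am => [//|m b] am; rewrite last_rcons; apply: am; rewrite mem_rcons inE eqxx.
Qed.

Definition chain_box N K : seq (seq nat) :=
  undup (flatten [seq chains r N | r <- iota 0 (N + K).+1]).

Lemma mem_chain_box N K m :
  (m \in chain_box N K) = (size m <= N + K)%N && all (fun b => (b <= N)%N) m.
Proof.
rewrite mem_undup; apply/flatten_mapP/idP => [[r]|/andP[sm am]].
  by rewrite mem_iota mem_chains => rK /andP[/eqP-> ->]; rewrite andbT; lia.
by exists (size m); rewrite ?mem_chains ?eqxx ?am // mem_iota; lia.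
Qed.

Definition chain_wt P m : C :=
  if (size m == size P) && path e 0 m then chain_prod P m else 0.

(** The connector and the coupling of the slots see a chain only through its last entry, which is
    why weights [phi] of that entry suffice. *)
Lemma sum_chain_box P N K (phi : nat -> C) : (size P <= K)%N ->
  \sum_(m <- chain_box N K) chain_wt P m * phi (last 0%N m) =
  \sum_(q < N.+1) chain_gf e P q * phi q.
Proof.
move=> PK.
transitivity (\sum_(m <- chains (size P) N | path e 0 m)
   chain_prod P m * phi (last 0%N m)).
  rewrite (bigID (fun m => size m == size P)) /= [X in _ + X]big1 ?addr0; last first.
    by move=> m /negbTE sm; rewrite /chain_wt sm mul0r.
  rewrite -big_filter (perm_big (chains (size P) N)) /=; last first.
    apply: uniq_perm; rewrite ?filter_uniq ?undup_uniq ?uniq_chains // => m.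
    rewrite mem_filter mem_chain_box mem_chains; case: eqP => //= ->.
    by rewrite (leq_trans PK) ?leq_addl.
  rewrite [RHS]big_mkcond big_seq [RHS]big_seq; apply: eq_bigr => m.
  by rewrite mem_chains /chain_wt => /andP[-> _] /=; case: ifP => _; rewrite ?mul0r.
under [RHS]eq_bigr => q _ do rewrite -(sum_chains _ (leq_ord q)) mulr_suml.
rewrite (exchange_big_dep (path e 0%N)) /=; last by move=> q m _ /andP[].
rewrite big_seq_cond [RHS]big_seq_cond; apply: eq_bigr => m /andP[mc pm].
have lN : (last 0%N m < N.+1)%N by rewrite ltnS (last_chain_le mc).
rewrite (big_pred1 (Ordinal lN)) // => q.
by rewrite pm /= eq_sym.
Qed.
End GeneratingFunction.

(** * Truncated connected sums as coefficients of polynomial products *)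

Section ConnectedSum.
Variable R : realType.
Local Notation C := R[i].

Definition slot_poly M (f : nat -> C) : {poly C} :=
  \poly_(a < M) (a`!%:R * f a).

Lemma ltn_weak_step a b : ltn a b -> weak_step a b.
Proof. by rewrite /weak_step /=; lia. Qed.

(** The numerators of the connector move into the slots and its denominator to the chain right of
    the bar; the factors then interact only through the equation between the last entries. *)
Lemma ZtermE n (P : 'I_n -> array R) Q (x : summation_index n) :
  Zterm P Q x =
  (last 0%N x.2 == \sum_(j < n) last 0%N (x.1 j))%N%:R *
  (\prod_(j < n) ((last 0%N (x.1 j))`!%:R * chain_wt ltn (P j) (x.1 j))) *
  (chain_wt weak_step Q x.2 * ((last 0%N x.2)%:R / (last 0%N x.2)`!%:R)).
Proof.
rewrite /Zterm /admissible /chain_wt -path_weak_step.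
case: forallP => [H|H] /=; last first.
  suff [j /negbTE nj] : exists j, ~~ ((size (x.1 j) == size (P j)) && path ltn 0%N (x.1 j)).
    by rewrite [X in _ * X * _](bigD1 j) //= nj !(mulr0, mul0r).
  by apply/existsP; rewrite -negb_forall; apply/forallP.
case: eqP => sq /=; last by rewrite mul0r mulr0.
case: (path leq) => /=; last by rewrite mul0r mulr0.
case: eqP => qs /=; last by rewrite !mul0r.
rewrite mul1r big_split /= /connector -qs natr_prod.
under [X in _ = _ * X * _]eq_bigr => j _ do rewrite H.
rewrite -!mulrA; congr (_ * _); rewrite mulrCA; congr (_ * _).
by rewrite mulrC [_ * chain_prod _ _]mulrC -mulrA.
Qed.

(** Going through [seq_sub] makes the families of chains a finite type, as needed to expand a
    product of sums over the slots. *)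
Definition index_box n N K : seq (summation_index n) :=
  [seq ([ffun j => val (x.1 j)], val x.2) |
     x : {ffun 'I_n -> seq_sub (chain_box N K)} * seq_sub (chain_box N K)].

Lemma uniq_index_box n N K : uniq (index_box n N K).
Proof.
rewrite map_inj_uniq ?enum_uniq // => -[x y] [x' y'] /= [/ffunP xx /val_inj ->].
congr (_, _); apply/ffunP => j; apply: val_inj.
by have := xx j; rewrite !ffunE.
Qed.

Lemma mem_index_box n N K (x : summation_index n) :
  (x \in index_box n N K) = [forall j, x.1 j \in chain_box N K] && (x.2 \in chain_box N K).
Proof.
apply/mapP/andP => [[[u y] _ ->]|[/forallP xN yN]].
  by split; [apply/forallP => j /=; rewrite ffunE|]; apply: valP.
exists ([ffun j => SeqSub (xN j)], SeqSub yN); rewrite ?mem_enum //=.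
by case: x xN yN => x y /= xN yN; congr (_, _); apply/ffunP => j; rewrite !ffunE.
Qed.

Lemma sum_seq_sub (T : choiceType) (s : seq T) (V : nmodType) (F : T -> V) :
  uniq s -> \sum_(t : seq_sub s) F (val t) = \sum_(t <- s) F t.
Proof.
move=> us; rewrite -(big_map val xpredT F); apply: perm_big.
apply: uniq_perm => //; first by rewrite map_inj_uniq ?index_enum_uniq //; apply: val_inj.
move=> t; apply/mapP/idP => [[u _ ->]|ts]; first exact: valP.
by exists (SeqSub ts); rewrite ?mem_index_enum.
Qed.

(** Expanding the product of the slot polynomials picks one chain per slot, with its last entry as
    exponent; extracting the coefficient of [X^q] is then the coupling condition on the last
    entries. *)
Lemma sum_Zterm n (P : 'I_n -> array R) Q N K :
  (forall j, size (P j) <= K)%N -> (size Q <= K)%N ->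
  \sum_(x <- index_box n N K) Zterm P Q x =
  \sum_(q < N.+1) chain_gf weak_step Q q * (q%:R / q`!%:R *
     (\prod_(j < n) slot_poly N.+1 (chain_gf ltn (P j)))`_q).
Proof.
move=> PK QK; rewrite big_map big_enum /=.
pose T := seq_sub (chain_box N K).
pose F (x : {ffun 'I_n -> T}) (y : T) := Zterm P Q ([ffun j => val (x j)], val y).
rewrite -(pair_bigA _ F) exchange_big /=.
under eq_bigr => y _ do (under eq_bigr => x _ do rewrite /F ZtermE /=).
pose p := \prod_(j < n) slot_poly N.+1 (chain_gf ltn (P j)).
rewrite -(sum_chain_box (fun a b H => H) N (fun q => q%:R / q`!%:R * p`_q) QK) {}/p.
rewrite -[RHS]sum_seq_sub ?undup_uniq //; apply: eq_bigr => y _.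
rewrite -mulr_suml [LHS]mulrC -[LHS]mulrA; congr (_ * (_ * _)).
set q := last 0%N _.
have -> : \prod_(j < n) slot_poly N.+1 (chain_gf ltn (P j)) =
   \prod_(j < n) \sum_(t : seq_sub (chain_box N K))
      ((last 0%N (val t))`!%:R * chain_wt ltn (P j) (val t)) *: 'X^(last 0%N (val t)).
  apply: eq_bigr => j _; apply/polyP => a; rewrite coef_poly coef_sum.
  under eq_bigr => t _ do rewrite coefZ coefXn [_ * chain_wt _ _ _]mulrC -mulrA.
  rewrite (sum_seq_sub (fun m => chain_wt ltn (P j) m *
    ((last 0%N m)`!%:R * (a == last 0%N m)%:R))) ?undup_uniq //.
  rewrite (sum_chain_box ltn_weak_step N (fun q => q`!%:R * (a == q)%:R) (PK j)).
  case: ltnP => aN; last first.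
    by rewrite big1 // => i _; rewrite gtn_eqF ?mulr0 // (leq_trans (ltn_ord i)).
  rewrite (bigD1 (Ordinal aN)) //= eqxx mulr1 mulrC big1 ?addr0 // => i.
  by rewrite -val_eqE eq_sym /= => /negbTE->; rewrite !mulr0.
rewrite bigA_distr_bigA coef_sum; apply: eq_bigr => x _ /=.
rewrite (eq_bigr (fun j => last 0%N (ssval (x j)))) => [|j _]; last by rewrite ffunE.
rewrite [X in _ * X](eq_bigr (fun j => (last 0%N (ssval (x j)))`!%:R *
  chain_wt ltn (P j) (ssval (x j)))) => [|j _]; last by rewrite ffunE.
by rewrite scaler_prod -expr_sum coefZ coefXn mulrC.
Qed.

End ConnectedSum.

(** * The Leibniz rule and the telescoping identity for abstract solutions of the recursions *)

Lemma coef_prod_eq (A : nzRingType) (I : finType) (p r : I -> {poly A}) q :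
  (forall j a, (a <= q)%N -> (p j)`_a = (r j)`_a) ->
  (\prod_j p j)`_q = (\prod_j r j)`_q.
Proof.
move=> pr; move: (leqnn q); move: {1 3 4}q.
apply: (big_ind2 (fun x y : {poly A} => forall a, (a <= q)%N -> x`_a = y`_a)) => //.
  move=> x1 x2 y1 y2 H1 H2 a aq; rewrite !coefM; apply: eq_bigr => i _.
  by rewrite H1 ?H2 // (leq_trans _ aq) ?leq_ord ?leq_subr.
by move=> j _ a aq; apply: pr.
Qed.

Lemma deriv_prod (A : comNzRingType) (I : eqType) (s : seq I) (p : I -> {poly A}) :
  uniq s -> (\prod_(j <- s) p j)^`() =
  \sum_(j <- s) (p j)^`() * \prod_(k <- s | k != j) p k.
Proof.
elim: s => [|x s IH] /=; first by rewrite !big_nil derivC.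
move=> /andP[xs us]; rewrite !big_cons derivM eqxx /=; congr (_ * _ + _).
  rewrite big_seq [RHS]big_seq_cond; apply: eq_bigl => k.
  by case: eqP => [->|_]; rewrite ?andbT // (negbTE xs).
rewrite IH // mulr_sumr [LHS]big_seq [RHS]big_seq; apply: eq_bigr => j js.
rewrite big_cons; case: eqP => [xj|_]; first by rewrite -xj (negbTE xs) in js.
by rewrite mulrCA.
Qed.

Section Identity.
Variables (R : realType) (n : nat).
Local Notation C := R[i].
Variables (f F : 'I_n -> nat -> C) (u : 'I_n -> C) (g G : nat -> C).
Hypothesis n2 : (2 <= n)%N.
Hypothesis F0 : forall j, F j 0%N = 0.
Hypothesis fF : forall j a,
  f j a = u j * (a.+1%:R * F j a.+1) - a%:R * F j a.
Local Notation v := (\sum_j u j).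
(** The term with [g 0] accounts for an empty array right of the bar, for which this value is 1. *)
Hypothesis gG : forall q,
  q.+1%:R * G q.+1 = v * (q%:R * G q + (q == 0%N)%:R * g 0%N) + g q.+1.

Definition swap_slot j k := if k == j then f k else F k.

Definition slot_coef (w : 'I_n -> nat -> C) q := (\prod_k slot_poly q.+1 (w k))`_q.

Lemma slot_coefE w M q : (q < M)%N ->
  (\prod_k slot_poly M (w k))`_q = slot_coef w q.
Proof.
move=> qM; apply: coef_prod_eq => k a aq.
by rewrite !coef_poly ltnS aq (leq_ltn_trans aq qM).
Qed.

(* With Psi_k = sum a! F_k(a) X^a, the hypothesis fF says that
   X Phi_k = u_k Psi_k - X^2 Psi_k' up to truncation, and the identity is the
   Leibniz rule for the product of the Psi_k. *)
Lemma sum_swap_slot q :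
  \sum_j slot_coef (swap_slot j) q =
  v * slot_coef F q.+1 - q%:R * slot_coef F q.
Proof.
pose Psi k := slot_poly q.+2 (F k).
have step j : slot_coef (swap_slot j) q =
    ((u j *: Psi j - 'X^2 * (Psi j)^`()) * \prod_(k | k != j) Psi k)`_q.+1.
  rewrite -(slot_coefE _ (leqW (leqnn q.+1))) (bigD1 j) //=.
  rewrite /swap_slot eqxx.
  rewrite (eq_bigr Psi) => [|k /negbTE->]; last by [].
  transitivity (('X * slot_poly q.+2 (f j) * \prod_(k | k != j) Psi k)`_q.+1).
    by rewrite -mulrA coefXM.
  rewrite !coefM; apply: eq_bigr => a _; congr (_ * _).
  rewrite coefXM coefB coefZ coefXnM coef_deriv !coef_poly.
  case: a => -[|a] /= aq; first by rewrite F0 mulr0 mulr0 subr0.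
  rewrite ltnW // aq fF.
  case: a aq => [|a] aq /=; first by rewrite mul0r !subr0 mul1r.
  rewrite subn2 /= ltnW // -mulr_natr (factS a.+1) natrM; ring.
rewrite (eq_bigr _ (fun j _ => step j)) -coef_sum.
under eq_bigr => j _ do rewrite mulrBl -scalerAl -mulrA.
rewrite big_split /= sumrN -mulr_sumr.
have -> : \sum_j (Psi j)^`() * \prod_(k | k != j) Psi k = (\prod_k Psi k)^`().
  by rewrite deriv_prod // index_enum_uniq.
rewrite (eq_bigr (fun j => u j *: \prod_k Psi k)) => [|j _]; last first.
  by rewrite [in RHS](bigD1 j).
rewrite -scaler_suml coefB coefZ slot_coefE // coefXnM coef_deriv.
rewrite {step}/Psi; case: q => [|q] /=; first by rewrite mul0r subr0.
by rewrite subSS subn1 /= (slot_coefE F (leqnSn q.+2)) mulr_natl.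
Qed.

(** At least two factors have zero constant term, so the product starts in degree 2. This removes
    the [g 0] term of [gG] from the telescoping. *)
Lemma slot_coef1 : slot_coef F 1 = 0.
Proof.
have p0 j : (slot_poly 2 (F j))`_0 = 0 by rewrite coef_poly F0 mulr0.
rewrite /slot_coef (bigD1 (Ordinal (ltnW n2))) //= (bigD1 (Ordinal n2)) //=.
by rewrite coefM big_ord_recl big_ord1 /= p0 mul0r add0r coef0M p0 mul0r mulr0.
Qed.

(** By [sum_swap_slot] and [gG] the total summand at a positive [q] is [B q - B (q - 1)], where
    [B q] is the right side for [N = q]; moreover [B 0 = 0]. *)
Lemma telescope_slots N :
  \sum_j \sum_(q < N.+1) G q * (q%:R / q`!%:R * slot_coef (swap_slot j) q)
  + \sum_(q < N.+1) g q * (q%:R / q`!%:R * slot_coef F q)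
  = v * slot_coef F N.+1 * (N%:R * G N) / N`!%:R.
Proof.
rewrite exchange_big /= -big_split /=.
rewrite (eq_bigr (fun q : 'I_N.+1 => q%:R / q`!%:R * (G q *
   (v * slot_coef F q.+1 - q%:R * slot_coef F q) + g q * slot_coef F q))); last first.
  move=> q _; rewrite -sum_swap_slot mulrDr !mulr_sumr; congr (_ + _).
    by apply: eq_bigr => j _; rewrite mulrCA.
  by rewrite mulrCA.
elim: N => [|N IH]; first by rewrite big_ord1 !mul0r mulr0 mul0r.
rewrite big_ord_recr /= {}IH.
have nf : N`!%:R != 0 :> C by rewrite pnatr_eq0 -lt0n fact_gt0.
have n1 : N.+1%:R != 0 :> C by rewrite pnatr_eq0.
have gE : g N.+1 * slot_coef F N.+1 =
    (N.+1%:R * G N.+1 - v * (N%:R * G N)) * slot_coef F N.+1.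
  rewrite gG; case: N {nf n1} => [|N] /=; first by rewrite slot_coef1 !mulr0.
  by rewrite mul0r addr0 addrAC subrr add0r.
rewrite gE factS natrM.
move: (slot_coef F N.+1) (slot_coef F N.+2) (G N.+1) (G N) => a b c d.
move: (v) n1 nf; move: (N.+1%:R : C) (N`!%:R : C) => x y vv x0 y0; field.
by apply/andP.
Qed.
End Identity.

(** * First order recursions satisfied by arrays with an arrow *)

Section Recursions.
Variable R : realType.
Local Notation C := R[i].
Implicit Types (P : array R) (e : rel nat).

Lemma up_rcons P c : up (rcons P c) = rcons P (c.1, c.2.+1).
Proof.
rewrite /up; case: P => [|c' P] //=.
by rewrite belast_rcons last_rcons.
Qed.

Lemma gf_up e P b : P <> [::] -> chain_gf e (up P) b = chain_gf e P b / b%:R.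
Proof.
case/lastP: P => [//|P c] _.
by rewrite up_rcons !gf_rcons /gf_step /= exprS invfM mulrA mulrAC.
Qed.

Lemma gf_nil e b : chain_gf e [::] b = (b == 0%N)%:R :> C.
Proof. by []. Qed.

Lemma gf0 e P : (forall a b, e a b -> weak_step a b) -> P <> [::] -> chain_gf e P 0 = 0.
Proof.
move=> he; case/lastP: P => [//|P c] _; rewrite gf_rcons /gf_step.
by rewrite big1 ?mul0r // => a /he /andP[].
Qed.

Lemma gf_push e P c b : (forall a b, e a b -> weak_step a b) ->
  b%:R * chain_gf e (push c P) b = \sum_(a < b.+1 | e a b) chain_gf e P a * c ^+ (b - a).
Proof.
move=> he; rewrite gf_rcons /gf_step /= expr1; case: b => [|b].
  by rewrite mul0r big1 // => a /he /andP[].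
by rewrite mulrC divfK // pnatr_eq0.
Qed.

(** The predecessor [k = a] is new in the sum for [a + 1]; all the others only gain a factor [c]. *)
Lemma gf_push_strict P (c : C) a :
  a.+1%:R * chain_gf ltn (push c P) a.+1 = c * (a%:R * chain_gf ltn (push c P) a + chain_gf ltn P a).
Proof.
have strict b : b%:R * chain_gf ltn (push c P) b = \sum_(k < b) chain_gf ltn P k * c ^+ (b - k).
  rewrite gf_push; last exact: ltn_weak_step.
  rewrite big_mkcond big_ord_recr /= ltnn addr0; apply: eq_bigr => k _.
  by rewrite ltn_ord.
rewrite !strict big_ord_recr /= subSnn expr1 mulrDr [c * chain_gf _ _ _]mulrC; congr (_ + _).
rewrite mulr_sumr; apply: eq_bigr => k _.
by rewrite subSn ?(ltnW (ltn_ord k)) // exprS mulrCA.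
Qed.

(** Here the new predecessor is [a + 1] itself. As [weak_step 0 0] fails, the predecessor 0 is
    missing from the sum at 0 but present from 1 on, whence the correction at [a = 0]. *)
Lemma gf_push_weak P (c : C) a :
  a.+1%:R * chain_gf weak_step (push c P) a.+1 =
  c * (a%:R * chain_gf weak_step (push c P) a + (a == 0%N)%:R * chain_gf weak_step P 0) + chain_gf weak_step P a.+1.
Proof.
rewrite !gf_push // big_mkcond big_ord_recr /= subnn expr0 mulr1.
rewrite /weak_step leqnn /=; congr (_ + _).
transitivity (c * \sum_(k < a.+1) chain_gf weak_step P k * c ^+ (a - k)).
  rewrite mulr_sumr; apply: eq_bigr => k _.
  have ka : (k <= a)%N by rewrite -ltnS.
  by rewrite (leqW ka) /= subSn // exprS mulrCA.
congr (_ * _); case: a => [|a] /=.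
  by rewrite big_ord1 mulr1 mul1r big1 ?add0r // => i /andP[].
rewrite mul0r addr0 [RHS]big_mkcond; apply: eq_bigr => k _.
by rewrite -ltnS ltn_ord.
Qed.

Lemma gf_arrow_weak P (c : C) a :
  a.+1%:R * chain_gf weak_step (arrow c P) a.+1 =
  c * (a%:R * chain_gf weak_step (arrow c P) a + (a == 0%N)%:R * chain_gf weak_step P 0) + chain_gf weak_step P a.+1.
Proof.
rewrite /arrow; case: eqP => [->|_]; last exact: gf_push_weak.
rewrite mul0r add0r; case: P => [|c' P]; first by rewrite !gf_nil mulr0.
by rewrite gf_up // mulrC divfK // pnatr_eq0.
Qed.

Definition signed_gf (S : signed_array R) a : C := (-1) ^+ S.1 * chain_gf ltn S.2 a.

(** For [v] infinite the coefficient [1/v] vanishes and the sign of the arrow turns [- a F(a)] into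
    the chain sum of [P]. At [a = 0] this would fail for an empty [P], whose chain sum there is 1:
    here condition (1) enters. *)
Lemma sgf_sarrow (v : option C) P a :
  (forall c, v = Some c -> c <> 0) -> (P = [::] -> v <> None) ->
  chain_gf ltn P a = inv_ext v * (a.+1%:R * signed_gf (sarrow v P) a.+1)
               - a%:R * signed_gf (sarrow v P) a.
Proof.
case: v => [c|] /=; rewrite /signed_gf /=.
  move=> /(_ _ erefl) /eqP c0 _; rewrite /arrow (negbTE c0) !mul1r gf_push_strict.
  by rewrite mulKf // addrAC subrr add0r.
move=> _; case: P => [/(_ erefl)//|c' P] _.
rewrite mul0r sub0r mulN1r mulrN opprK gf_up //; case: a => [|a].
  by rewrite mul0r (gf0 ltn_weak_step).
by rewrite mulrC divfK // pnatr_eq0.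
Qed.

End Recursions.

(** * Growth of chain sums *)

Section GfBounds.
Variable R : realType.
Local Notation C := R[i].
Local Notation h := (harm C).
Implicit Types (P : array R).
Variables (e : rel nat) (he : forall a b, e a b -> weak_step a b).

Lemma is_array_rcons P c :
  is_array (rcons P c) = [&& `|c.1| <= 1, (0 < c.2)%N & is_array P].
Proof. by rewrite /is_array all_rcons /in_disk andbA. Qed.

Lemma sum_inv b : \sum_(a < b.+1) (a%:R)^-1 = h b - 1 :> C.
Proof. by rewrite big_ord_recl invr0 add0r /harm addrC addKr. Qed.

(** Induction on the last column: summing [1/a] over the predecessors gives one more factor [harm],
    and the positive exponent of the column provides [1/b]. *)
Lemma gf_le P b : is_array P -> P <> [::] ->
  `|chain_gf e P b| <= h b ^+ size P / b%:R.
Proof.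
elim/last_ind: P b => [//|P c IH] b; rewrite is_array_rcons => /and3P[c1 c2 aP] _.
case: b => [|b].
  rewrite gf0 ?normr0 ?divr_ge0 ?exprn_ge0 ?harm_ge0 //; by case: (P).
rewrite gf_rcons /gf_step size_rcons normrM normfV normrX normr_nat.
apply: (@le_trans _ _ (h b.+1 ^+ (size P).+1 / b.+1%:R ^+ c.2)); last first.
  rewrite ler_wpM2l ?exprn_ge0 ?harm_ge0 // lef_pV2 ?posrE ?exprn_gt0 ?ltr0n //.
  by rewrite -[leLHS]expr1 ler_weXn2l // ler1n.
rewrite ler_wpM2r ?invr_ge0 ?exprn_ge0 ?ler0n //.
apply: le_trans (ler_norm_sum _ _ _) _.
apply: (@le_trans _ _ (\sum_(a < b.+2) `|chain_gf e P a|)).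
  rewrite big_mkcond ler_sum // => a _; case: ifP => // _.
  by rewrite normrM normrX ler_piMr // exprn_ile1.
case: (P =P [::]) => [->|Pn].
  rewrite big_ord_recl big1 => [|a _]; last by rewrite gf_nil normr0.
  by rewrite gf_nil normr1 addr0 expr1 harm_ge1.
apply: (@le_trans _ _ (\sum_(a < b.+2) h b.+1 ^+ size P * (a%:R)^-1)).
  apply: ler_sum => a _; apply: le_trans (IH a aP Pn) _.
  by rewrite ler_wpM2r ?invr_ge0 ?ler0n // le_harmX // -ltnS.
rewrite -mulr_sumr sum_inv exprSr ler_wpM2l ?exprn_ge0 ?harm_ge0 // gerBl.
exact: ler01.
Qed.

Lemma mul_gf_le P b : is_array P -> P <> [::] ->
  b%:R * `|chain_gf e P b| <= h b ^+ size P.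
Proof.
move=> aP Pn; case: b => [|b]; first by rewrite mul0r exprn_ge0 ?harm_ge0.
by rewrite mulrC -ler_pdivlMr ?ltr0n // gf_le.
Qed.

Lemma sqr_gf_up_le P b : is_array P -> P <> [::] ->
  b%:R ^+ 2 * `|chain_gf e (up P) b| <= h b ^+ size P.
Proof.
move=> aP Pn; case: b => [|b]; first by rewrite expr0n mul0r exprn_ge0 ?harm_ge0.
rewrite gf_up // normrM normfV normr_nat expr2 -mulrA [X in _ * X]mulrC.
by rewrite divfK ?pnatr_eq0 // mul_gf_le.
Qed.

(** The powers of [c] concentrate the sum on predecessors [a] close to [b]. For [1 <= a <= b] one
    has [b <= (b - a + 1) a]; the factor [a] is absorbed by [mul_gf_le], and the rest is summed by
    [sum_geom_le]. *)
Lemma sqr_gf_push_le P (c : C) b : is_array P -> `|c| < 1 ->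
  b%:R ^+ 2 * `|chain_gf e (push c P) b| <= (1 - `|c|) ^- 2 * h b ^+ size P.
Proof.
move=> aP c1.
rewrite expr2 -mulrA -[X in _ * (X * _)]normr_nat -normrM gf_push //.
apply: le_trans (ler_wpM2l (ler0n _ b) (ler_norm_sum _ _ _)) _.
rewrite mulr_sumr.
apply: (@le_trans _ _ (\sum_(a < b.+1) ((b - a).+1%:R * `|c| ^+ (b - a)) * h b ^+ size P)).
  rewrite big_mkcond ler_sum // => a _; case: ifP => _; last first.
    by rewrite mulr_ge0 ?exprn_ge0 ?harm_ge0 // mulr_ge0 ?exprn_ge0 ?ler0n.
  rewrite normrM normrX mulrA [leRHS]mulrAC ler_wpM2r ?exprn_ge0 //.
  have ab : (a <= b)%N by rewrite -ltnS.
  case: (P =P [::]) => [->|Pn].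
    rewrite gf_nil mulr1 normr_nat -natrM ler_nat.
    by case: (a : nat) => [|k]; rewrite ?muln0 // muln1 subn0.
  have [a0|a0] := posnP a; first by rewrite a0 gf0 // normr0 mulr0 mulr_ge0 ?exprn_ge0 ?harm_ge0 ?ler0n.
  apply: (@le_trans _ _ ((b - a).+1%:R * (a%:R * `|chain_gf e P a|))).
    by rewrite mulrA ler_wpM2r // -natrM ler_nat; nia.
  rewrite ler_wpM2l ?ler0n //; apply: le_trans (mul_gf_le a aP Pn) _.
  exact: le_harmX.
rewrite -mulr_suml ler_wpM2r ?exprn_ge0 ?harm_ge0 //.
rewrite (reindex_inj rev_ord_inj) /=.
apply: le_trans (sum_geom_le b.+1 (normr_ge0 c) c1).
rewrite le_eqVlt; apply/orP; left; apply/eqP; apply: eq_bigr => a _.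
by rewrite subSS subKn // -ltnS.
Qed.
End GfBounds.

(** * Bounds for the coefficients of products of slots *)

Section SlotBounds.
Variable R : realType.
Local Notation C := R[i].
Local Notation h := (harm C).

Lemma slot_poly_delta M : (0 < M)%N ->
  slot_poly M (fun a => (a == 0%N)%:R : C) = 1.
Proof.
move=> M0; apply/polyP => a; rewrite coef_poly coef1.
by case: a => [|a] /=; rewrite ?M0 ?mulr0 ?if_same ?mulr1.
Qed.

(** [B] marks the slots with a nonempty array. Each of them is dominated by a multiple of
    [fact_poly], and every other slot contributes the polynomial 1. *)
Lemma slot_coef_le n (B : pred 'I_n) (w : 'I_n -> nat -> C) K q :
  (forall j, B j -> w j 0%N = 0) ->
  (forall j, B j -> forall a, a%:R * `|w j a| <= h a ^+ K) ->
  (forall j, ~~ B j -> w j = fun a => (a == 0%N)%:R) ->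
  `|slot_coef w q| <= h q ^+ (K * #|B|) * (fact_poly C q.+1 ^+ #|B|)`_q.
Proof.
move=> w0 wB wN.
pose r j : {poly C} := if B j then (h q ^+ K) *: fact_poly C q.+1 else 1.
have -> : h q ^+ (K * #|B|) * (fact_poly C q.+1 ^+ #|B|)`_q = (\prod_j r j)`_q.
  by rewrite -big_mkcond /= prodr_const exprZn coefZ -exprM.
apply: coef_prod_le => j a aq; rewrite /r; case: ifPn => Bj; last first.
  by rewrite wN // slot_poly_delta // coef1 normr_nat.
rewrite coefZ coef_fact_poly ?ltnS // coef_poly ltnS aq normrM normr_nat.
case: posnP => [->|a0]; first by rewrite w0 // normr0 mulr0 mul0r mulr0.
rewrite mul1r mulrC -[in leLHS](prednK a0) factS (prednK a0) natrM mulrA.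
rewrite ler_wpM2r ?ler0n // [leLHS]mulrC; apply: le_trans (wB j Bj a) _.
exact: le_harmX.
Qed.

Lemma slot_coef_le2 n (B : pred 'I_n) (w : 'I_n -> nat -> C) K q :
  (2 <= #|B|)%N ->
  (forall j, B j -> w j 0%N = 0) ->
  (forall j, B j -> forall a, a%:R * `|w j a| <= h a ^+ K) ->
  (forall j, ~~ B j -> w j = fun a => (a == 0%N)%:R) ->
  `|slot_coef w q| <= (6 ^ #|B|.-1)%N%:R * h q ^+ (K * #|B|) * ((q.-1)`!%:R / q%:R).
Proof.
move=> B2 w0 wB wN; apply: le_trans (slot_coef_le q w0 wB wN) _.
case: #|B| B2 => [|[|m]] // _ /=.
rewrite [_%N%:R * _]mulrC -mulrA ler_wpM2l ?exprn_ge0 ?harm_ge0 // mulrA.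
exact: coef_fact_polyX_le.
Qed.

Definition slot_term n (w : 'I_n -> nat -> C) (g : nat -> C) q :=
  g q * (q%:R / q`!%:R * slot_coef w q).

(** One factor [1/q] comes from the convolution of at least two slots, after [q/q!] has cancelled
    [(q - 1)!]; the other one comes from the chain right of the bar. *)
Lemma slot_term_le2 n (B : pred 'I_n) (w : 'I_n -> nat -> C) g K q :
  (2 <= #|B|)%N ->
  (forall j, B j -> w j 0%N = 0) ->
  (forall j, B j -> forall a, a%:R * `|w j a| <= h a ^+ K) ->
  (forall j, ~~ B j -> w j = fun a => (a == 0%N)%:R) ->
  q%:R * `|g q| <= h q ^+ K ->
  `|slot_term w g q| <=
    (6 ^ #|B|.-1)%N%:R * (h q ^+ (K * #|B| + K) / q%:R ^+ 2).
Proof.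
move=> B2 w0 wB wN gq; rewrite /slot_term.
case: q gq => [|q] gq.
  by rewrite !mul0r mulr0 normr0 expr0n invr0 !mulr0.
have q0 : q.+1%:R != 0 :> C by rewrite pnatr_eq0.
have f0 : q`!%:R != 0 :> C by rewrite pnatr_eq0 -lt0n fact_gt0.
have c0 : 0 <= (q.+1)`!%:R^-1 :> C by rewrite invr_ge0 ler0n.
rewrite !normrM normfV !normr_nat mulrA mulrA [_ * q.+1%:R]mulrC.
have := slot_coef_le2 q.+1 B2 w0 wB wN; rewrite /= => sc.
apply: (@le_trans _ _ (h q.+1 ^+ K * (q.+1)`!%:R^-1 *
   ((6 ^ #|B|.-1)%N%:R * h q.+1 ^+ (K * #|B|) * (q`!%:R / q.+1%:R)))).
  apply: ler_pM => //.
  by rewrite ler_wpM2r.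
rewrite factS natrM exprD le_eqVlt; apply/orP; left; apply/eqP.
move: (q.+1%:R : C) (q`!%:R : C) q0 f0 => x y x0 y0.
by field; rewrite x0 y0.
Qed.

Lemma sum_sqr_bounded (T : nat -> nat -> C) (c : C) D : 0 <= c ->
  (forall N q, (q <= N)%N -> `|T N q| <= c * (h q ^+ D / q%:R ^+ 2)) ->
  exists2 M : C, 0 <= M & forall N, `|\sum_(q < N.+1) T N q| <= M.
Proof.
move=> c0 HT; have [M M0 HM] := sum_harm_sqr_bounded C D.
exists (c * M) => [|N]; first exact: mulr_ge0.
apply: le_trans (ler_norm_sum _ _ _) _.
apply: (@le_trans _ _ (\sum_(q < N.+1) c * (h q ^+ D / q%:R ^+ 2))).
  by apply: ler_sum => q _; apply: HT; rewrite -ltnS.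
rewrite -mulr_sumr ler_wpM2l // big_ord_recl expr0n invr0 mulr0 add0r.
exact: HM.
Qed.
End SlotBounds.

(** * Unordered sums of absolutely summable complex families *)

Section AbsoluteSums.
Variables (R : realType) (I : choiceType).
Local Notation C := R[i].

Definition sum_bounded (g : I -> R) :=
  exists M, forall s : seq I, uniq s -> \sum_(x <- s) g x <= M.

Lemma partial_sumE (V : zmodType) (f : I -> V) (A : {fset I}) :
  summability.partial_sum f A = \sum_(x <- A) f x.
Proof. by rewrite /summability.partial_sum big_seq_fsetE. Qed.

Lemma ler_sum_subset (K : numDomainType) (g : I -> K) (s t : seq I) :
  (forall x, 0 <= g x) -> uniq s -> uniq t -> {subset s <= t} ->
  \sum_(x <- s) g x <= \sum_(x <- t) g x.
Proof.
move=> g0 us ut st; rewrite [leRHS](bigID (fun x => x \in s)) /= -[leLHS]addr0.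
apply: lerD; last exact: sumr_ge0.
rewrite -[leRHS]big_filter le_eqVlt; apply/orP; left; apply/eqP; apply: perm_big.
apply: uniq_perm; rewrite ?filter_uniq // => x; rewrite mem_filter.
by case: (boolP (x \in s)) => // /st ->.
Qed.

Lemma sum_bounded_summable (f : I -> C) :
  sum_bounded (fun x => Normc.normc (f x)) -> abs_summable f.
Proof.
move=> [M HM]; rewrite /abs_summable /summable.
apply: (@le_lt_trans _ _ M%:E); last exact: ltry.
apply: ge_ereal_sup => _ [A [finA _] <-].
rewrite fsbig_finite //= (eq_bigr (fun x => (Normc.normc (f x))%:E)); last first.
  by move=> x _; rewrite ger0_norm //; case: (f x) => a b; apply: sqrtr_ge0.
by rewrite sumEFin lee_fin HM // fset_uniq.
Qed.

Lemma sum_bounded_cvg_ge0 (g : I -> R) : (forall x, 0 <= g x) -> sum_bounded g ->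
  exists l : R, summability.partial_sum g @ summability.totally --> l.
Proof.
move=> g0 [M HM].
pose S : set R := range (summability.partial_sum g).
have hS : has_sup S.
  split; first by exists (summability.partial_sum g fset0), fset0.
  by exists M => _ [A _ <-]; rewrite partial_sumE HM // fset_uniq.
exists (sup S); apply/cvgrPdist_lt => e e0.
have [_ [A _ <-] Ae] := sup_adherent e0 hS.
exists A => // B /= AB.
have BS : summability.partial_sum g B <= sup S by apply: ub_le_sup; [case: hS|exists B].
rewrite ger0_norm ?subr_ge0 // ltrBlDr -ltrBlDl; apply: lt_le_trans Ae _.
rewrite !partial_sumE; apply: ler_sum_subset; rewrite ?fset_uniq //.
exact/fsubsetP.
Qed.

(** [g] is the difference of the nonnegative families [g + k] and [k], whose partial sums increase
    to a supremum. *)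
Lemma sum_bounded_cvg_real (g k : I -> R) : (forall x, `|g x| <= k x) ->
  sum_bounded k ->
  exists l : R, summability.partial_sum g @ summability.totally --> l.
Proof.
move=> gk [M HM].
have k0 x : 0 <= k x by apply: le_trans (gk x).
have [a Ha] : exists l : R, summability.partial_sum k @ summability.totally --> l.
  by apply: sum_bounded_cvg_ge0 => //; exists M.
have [b Hb] : exists l : R,
    summability.partial_sum (fun x => g x + k x) @ summability.totally --> l.
  apply: sum_bounded_cvg_ge0 => [x|].
    by rewrite -lerBlDr sub0r; have := gk x; rewrite ler_norml => /andP[].
  exists (M + M) => s us; rewrite big_split /= lerD ?HM //.
  apply: le_trans (HM s us); apply: ler_sum => x _.
  exact: le_trans (ler_norm _) (gk x).
exists (b - a).
rewrite (_ : summability.partial_sum g =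
  summability.partial_sum (fun x => g x + k x) \- summability.partial_sum k).
  exact: cvgB.
apply/funext => A /=; rewrite !partial_sumE -sumrB; apply: eq_bigr => x _.
by rewrite addrK.
Qed.

Lemma ler_Re_normc (z : C) : `|complex.Re z| <= Normc.normc z.
Proof. by case: z => a b /=; rewrite -sqrtr_sqr ler_wsqrtr // lerDl sqr_ge0. Qed.

Lemma ler_Im_normc (z : C) : `|complex.Im z| <= Normc.normc z.
Proof. by case: z => a b /=; rewrite -sqrtr_sqr ler_wsqrtr // lerDr sqr_ge0. Qed.

Lemma ler_normc_ReIm (z : C) : `|z| <= (`|complex.Re z| + `|complex.Im z|)%:C.
Proof.
case: z => a b.
rewrite normc_def lecR /= -[leRHS]ger0_norm ?addr_ge0 // -sqrtr_sqr ler_wsqrtr //.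
by rewrite sqrrD !real_normK ?num_real // lerD2r lerDl mulrn_wge0 // mulr_ge0.
Qed.

Lemma sum_bounded_cvg (f : I -> C) : sum_bounded (fun x => Normc.normc (f x)) ->
  exists l : C^o, summability.partial_sum (f : I -> C^o) @ summability.totally --> l.
Proof.
move=> Hf.
have [a Ha] := sum_bounded_cvg_real (fun x => ler_Re_normc (f x)) Hf.
have [b Hb] := sum_bounded_cvg_real (fun x => ler_Im_normc (f x)) Hf.
exists (a +i* b : C^o); apply/cvgrPdist_lt => /= e e0.
(* In the partial order of [R[i]] a positive element is real. *)
have [r r0 ->] : exists2 r : R, 0 < r & e = r%:C.
  exists (complex.Re e); first by move: e0; rewrite ltcE => /andP[].
  by rewrite RRe_real // gtr0_real.
have r2 : 0 < r / 2 by rewrite divr_gt0.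
move/cvgrPdist_lt : Ha => /(_ _ r2) Ha; move/cvgrPdist_lt : Hb => /(_ _ r2) Hb.
near=> A.
apply: le_lt_trans (ler_normc_ReIm _) _; rewrite ltcR [r]splitr ltrD //.
  have -> : complex.Re (a +i* b - summability.partial_sum f A) =
      a - summability.partial_sum (fun x => complex.Re (f x)) A.
    rewrite !partial_sumE raddfB /= raddf_sum //.
  by near: A.
have -> : complex.Im (a +i* b - summability.partial_sum f A) =
    b - summability.partial_sum (fun x => complex.Im (f x)) A.
  rewrite !partial_sumE raddfB /= raddf_sum //.
by near: A.
Unshelve. all: by end_near.
Qed.

(** The sets [E N] eventually contain any given finite set, so partial sums along them share the
    limit of the net of all finite partial sums. *)
Lemma sum_bounded_cvg_seq (f : I -> C) (E : nat -> seq I) :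
  sum_bounded (fun x => Normc.normc (f x)) ->
  (forall N, uniq (E N)) ->
  (forall s : seq I, exists N0, forall N, (N0 <= N)%N -> {subset s <= E N}) ->
  (fun N => \sum_(x <- E N) f x : C^o) @ \oo --> (unordered_sum f : C^o).
Proof.
move=> /sum_bounded_cvg[l Hl] uE cE.
have -> : unordered_sum f = l by apply: (cvg_lim _ Hl); exact: norm_hausdorff.
have HE : (fun N => [fset x in E N]%fset) @ \oo --> (@summability.totally I).
  move=> S [A _ AS].
  have [N0 HN] := cE A; exists N0 => // N /= N0N; apply: AS => /=.
  by apply/fsubsetP => x xA; rewrite inE HN.
have -> : (fun N => \sum_(x <- E N) f x) =
    summability.partial_sum (f : I -> C^o) \o (fun N => [fset x in E N]%fset).
  apply/funext => N /=; rewrite partial_sumE.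
  apply: perm_big; apply: uniq_perm; rewrite ?fset_uniq // => x.
  by rewrite inE.
exact: cvg_comp HE Hl.
Qed.
End AbsoluteSums.

(** * Absolute convergence of connected sums *)

Section Convergence.
Variable R : realType.
Local Notation C := R[i].
Local Notation h := (harm C).
Implicit Types (P Q : array R) (e : rel nat).

Definition norm_array P : array R := [seq (`|c.1|, c.2) | c <- P].

Lemma size_norm_array P : size (norm_array P) = size P.
Proof. exact: size_map. Qed.

Lemma is_array_norm P : is_array (norm_array P) = is_array P.
Proof.
by rewrite /is_array all_map; apply: eq_all => c /=; rewrite /in_disk normr_id.
Qed.

Lemma norm_array_push c P : norm_array (push c P) = push `|c| (norm_array P).
Proof. exact: map_rcons. Qed.

Lemma norm_array_up P : norm_array (up P) = up (norm_array P).
Proof.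
case/lastP: P => [//|P c]; rewrite up_rcons /norm_array !map_rcons.
by rewrite (up_rcons _ (`|c.1|, c.2)).
Qed.

Lemma norm_array_nil P : norm_array P = [::] -> P = [::].
Proof. by case: P. Qed.

Lemma norm_Zterm n (P : 'I_n -> array R) Q x :
  `|Zterm P Q x| = Zterm (fun j => norm_array (P j)) (norm_array Q) x.
Proof.
have cp S m : chain_prod (norm_array S) m = `|chain_prod S m|.
  rewrite /chain_prod normr_prod size_norm_array; apply: eq_bigr => i _.
  by rewrite (nth_map (0, 0%N)) // normrM normfV !normrX normr_nat.
have adm : admissible (fun j => norm_array (P j)) (norm_array Q) x = admissible P Q x.
  rewrite /admissible size_norm_array; congr (_ && _).
  by apply: eq_forallb => j; rewrite size_norm_array.
rewrite /Zterm adm; case: ifP => _; last by rewrite normr0.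
rewrite !normrM normr_prod normr_nat cp.
rewrite /connector normfV !normr_nat; congr (_ * _ * _).
by apply: eq_bigr => j _; rewrite cp.
Qed.

Lemma index_box_exhaust n K (s : seq (summation_index n)) :
  exists N0, forall N, (N0 <= N)%N -> {subset s <= index_box n N K}.
Proof.
(* This weight bounds the length and every entry of a list at once. *)
pose w (m : seq nat) := (size m + sumn m)%N.
have wbox m N : (w m <= N)%N -> m \in chain_box N K.
  move=> mN; rewrite mem_chain_box (leq_trans (leq_trans (leq_addr _ _) mN) (leq_addr _ _)) /=.
  apply/allP => b bm; apply: leq_trans mN; apply: leq_trans (leq_addl _ _).
  by rewrite (perm_sumn (perm_to_rem bm)) /= leq_addr.
pose W (x : summation_index n) := (\sum_(j < n) w (x.1 j) + w x.2)%N.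
exists (\sum_(x <- s) W x)%N => N sN x xs.
have xN : (W x <= N)%N.
  apply: leq_trans sN; rewrite (perm_big _ (perm_to_rem xs)) big_cons leq_addr.
  by [].
rewrite mem_index_box; apply/andP; split; last first.
  by apply: wbox; apply: leq_trans xN; rewrite leq_addl.
apply/forallP => j; apply: wbox; apply: leq_trans xN.
by rewrite /W (bigD1 j) //= -addnA leq_addr.
Qed.

(* |Zterm P Q| is Zterm of the arrays of moduli, hence its sums over boxes are
   given by the same generating functions. *)
Lemma Zterm_sum_bounded n (P : 'I_n -> array R) Q (c : C) D : 0 <= c ->
  (forall q, `|slot_term (fun j => chain_gf ltn (norm_array (P j)))
                 (chain_gf weak_step (norm_array Q)) q| <= c * (h q ^+ D / q%:R ^+ 2)) ->
  sum_bounded (fun x => Normc.normc (Zterm P Q x)).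
Proof.
move=> c0 H.
pose K := (\sum_(j < n) size (P j) + size Q)%N.
have [M M0 HM] := sum_sqr_bounded (T := fun _ => slot_term _ _) c0 (fun _ q _ => H q).
exists (complex.Re M) => s us.
suff : (\sum_(x <- s) Normc.normc (Zterm P Q x))%:C <= M by rewrite lecE => /andP[].
rewrite rmorph_sum /=.
have [N0 HN] := index_box_exhaust K s.
rewrite (eq_bigr (fun x => `|Zterm P Q x|)) //.
apply: (@le_trans _ _ (\sum_(x <- index_box n N0 K) `|Zterm P Q x|)).
  by apply: ler_sum_subset; rewrite ?uniq_index_box //; apply: HN.
rewrite -[leLHS]ger0_norm ?sumr_ge0 //; apply: le_trans (HM N0).
rewrite (eq_bigr _ (fun x _ => norm_Zterm P Q x)) sum_Zterm; first last.
- by rewrite size_norm_array leq_addl.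
- by move=> j; rewrite size_norm_array /K (bigD1 j) //= -addnA leq_addr.
rewrite le_eqVlt; apply/orP; left; apply/eqP; congr `|_|.
by apply: eq_bigr => q _; rewrite slot_coefE.
Qed.

Lemma Z_cvg n (P : 'I_n -> array R) Q :
  sum_bounded (fun x => Normc.normc (Zterm P Q x)) ->
  (fun N => \sum_(q < N.+1) slot_term (fun j => chain_gf ltn (P j)) (chain_gf weak_step Q) q : C^o)
    @ \oo --> (Z P Q : C^o).
Proof.
case: Q => [_|c Q bP].
  (* The convention for an empty right array agrees with the formula: the factor [q] kills the
     summand at 0, and [chain_gf] the others. *)
  rewrite (_ : (fun N => _) = (fun=> 0)); first exact: cvg_cst.
  apply/funext => N; rewrite big1 // => -[[|q] ? _]; rewrite /slot_term /=.
    by rewrite !mul0r mulr0.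
  by rewrite gf_nil mul0r.
pose K := (\sum_(j < n) size (P j) + size (c :: Q))%N.
have -> : Z P (c :: Q) = unordered_sum (Zterm P (c :: Q)) by [].
have -> : (fun N => \sum_(q < N.+1) slot_term (fun j => chain_gf ltn (P j)) (chain_gf weak_step (c :: Q)) q) =
    (fun N => \sum_(x <- index_box n N K) Zterm P (c :: Q) x).
  apply/funext => N; rewrite sum_Zterm; first last.
  - by rewrite leq_addl.
  - by move=> j; rewrite /K (bigD1 j) //= -addnA leq_addr.
  by apply: eq_bigr => q _; rewrite slot_coefE.
exact: sum_bounded_cvg_seq bP (fun N => uniq_index_box n N K) (@index_box_exhaust n K).
Qed.

Lemma mul_gf_le_max e P K b : (forall a b, e a b -> weak_step a b) ->
  is_array P -> (size P <= K)%N -> b%:R * `|chain_gf e P b| <= h b ^+ K.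
Proof.
move=> he aP PK; case: (P =P [::]) => [->|Pn].
  by rewrite gf_nil; case: b => [|b]; rewrite ?mul0r ?normr0 ?mulr0 ?exprn_ge0 ?harm_ge0.
exact: le_trans (mul_gf_le he b aP Pn) (le_harmX _ PK (leqnn b)).
Qed.

Lemma Zterm_sum_bounded2 n (P : 'I_n -> array R) Q :
  (forall j, is_array (P j)) -> is_array Q ->
  (2 <= #|[pred j | ~~ nilp (P j)]|)%N ->
  sum_bounded (fun x => Normc.normc (Zterm P Q x)).
Proof.
move=> aP aQ B2; set B := [pred j | _] in B2.
pose K := (\sum_(j < n) size (P j) + size Q)%N.
have PK j : (size (P j) <= K)%N by rewrite /K (bigD1 j) //= -addnA leq_addr.
apply: (@Zterm_sum_bounded _ _ _ (6 ^ #|B|.-1)%N%:R (K * #|B| + K)).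
  exact: ler0n.
move=> q; apply: slot_term_le2 => //.
- move=> j; rewrite /B /= => /nilP Pj; rewrite gf0 //; first exact: ltn_weak_step.
  by move=> /norm_array_nil.
- move=> j _ a; apply: mul_gf_le_max; rewrite ?is_array_norm ?size_norm_array //.
  exact: ltn_weak_step.
- by move=> j; rewrite /B /= negbK => /nilP->.
by apply: mul_gf_le_max; rewrite ?is_array_norm ?size_norm_array ?leq_addl.
Qed.

(** One factor [1/q] better than the general bound [gf_le], up to powers of harmonic numbers. *)
Definition decays e P := exists c D, 0 <= c /\
  forall q, q%:R ^+ 2 * `|chain_gf e (norm_array P) q| <= c * h q ^+ D.

Lemma decays_up e P : (forall a b, e a b -> weak_step a b) ->
  is_array P -> decays e (up P).
Proof.
move=> he aP; case: (P =P [::]) => [->|Pn].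
  exists 0, 0%N; split => // q; rewrite gf_nil mul0r.
  by case: q => [|q]; rewrite ?expr0n ?mul0r ?normr0 ?mulr0.
exists 1, (size P); split=> // q; rewrite mul1r norm_array_up.
rewrite -size_norm_array; apply: sqr_gf_up_le => //; rewrite ?is_array_norm //.
by move=> /norm_array_nil.
Qed.

Lemma decays_push e P c : (forall a b, e a b -> weak_step a b) ->
  is_array P -> `|c| < 1 -> decays e (push c P).
Proof.
move=> he aP c1; exists ((1 - `|c|) ^- 2), (size P); split.
  by rewrite invr_ge0 exprn_ge0 // subr_ge0 ltW.
move=> q; rewrite norm_array_push -size_norm_array -[in leRHS](normr_id c).
by apply: sqr_gf_push_le; rewrite ?is_array_norm ?normr_id.
Qed.

Lemma decays_arrow e P c : (forall a b, e a b -> weak_step a b) ->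
  is_array P -> `|c| < 1 -> decays e (arrow c P).
Proof.
move=> he aP c1; rewrite /arrow; case: ifP => _; first exact: decays_up.
exact: decays_push.
Qed.

(** With all slots but one empty the connector is 1, and the summand is [q f(q) g(q)]. The general
    bounds leave only [1/q], so one of the two factors has to decay faster. *)
Lemma Zterm_sum_bounded1 n (P : 'I_n -> array R) Q j0 :
  (forall j, is_array (P j)) -> is_array Q -> (forall j, j != j0 -> P j = [::]) ->
  decays ltn (P j0) \/ decays weak_step Q ->
  sum_bounded (fun x => Normc.normc (Zterm P Q x)).
Proof.
move=> aP aQ Pj0 dPQ.
pose f := chain_gf ltn (norm_array (P j0)); pose g := chain_gf weak_step (norm_array Q).
have st q : slot_term (fun j => chain_gf ltn (norm_array (P j))) g q = q%:R * (g q * f q).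
  rewrite /slot_term /slot_coef (bigD1 j0) //= big1 => [|j /Pj0 ->]; last first.
    exact: slot_poly_delta.
  rewrite mulr1 coef_poly ltnSn [_ / _ * _]mulrA.
  by rewrite divfK ?pnatr_eq0 -?lt0n ?fact_gt0 // mulrCA.
have fK q : q%:R * `|f q| <= h q ^+ size (P j0).
  by apply: mul_gf_le_max; rewrite ?is_array_norm ?size_norm_array //; apply: ltn_weak_step.
have gK q : q%:R * `|g q| <= h q ^+ size Q.
  by apply: mul_gf_le_max; rewrite ?is_array_norm ?size_norm_array.
have bnd (a b : nat -> C) c D E : 0 <= c ->
    (forall q, q%:R ^+ 2 * `|a q| <= c * h q ^+ D) ->
    (forall q, q%:R * `|b q| <= h q ^+ E) ->
    forall q, `|q%:R * (a q * b q)| <= c * (h q ^+ (D + E) / q%:R ^+ 2).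
  move=> c0 Ha Hb [|q]; first by rewrite mul0r normr0 expr0n invr0 !mulr0.
  rewrite [leRHS]mulrA ler_pdivlMr ?exprn_gt0 ?ltr0n // !normrM normr_nat exprD [leRHS]mulrA.
  have -> (x y z : C) : x * (y * z) * x ^+ 2 = (x ^+ 2 * y) * (x * z) by ring.
  by apply: ler_pM; rewrite ?mulr_ge0 ?exprn_ge0 ?ler0n.
case: dPQ => -[c [D [c0 Hd]]].
  apply: (Zterm_sum_bounded (D := D + size Q) c0) => q.
  by rewrite st [g q * _]mulrC; apply: bnd.
apply: (Zterm_sum_bounded (D := D + size (P j0)) c0) => q.
by rewrite st; apply: bnd.
Qed.

Lemma slot_term_sgf n (S : 'I_n -> signed_array R) g q :
  slot_term (fun j => signed_gf (S j)) g q =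
  (\prod_(j < n) (-1) ^+ (S j).1) * slot_term (fun j => chain_gf ltn (S j).2) g q.
Proof.
rewrite /slot_term /slot_coef; set c := \prod_(j < n) _.
have -> : \prod_k slot_poly q.+1 (signed_gf (S k)) =
    c *: \prod_k slot_poly q.+1 (chain_gf ltn (S k).2).
  rewrite /c -scaler_prod; apply: eq_bigr => k _; apply/polyP => a.
  rewrite coefZ !coef_poly /signed_gf; case: ifP; rewrite ?mulr0 // => _.
  by rewrite mulrCA.
by rewrite coefZ; ring.
Qed.

Lemma Zsigned_cvg n (S : 'I_n -> signed_array R) Q :
  sum_bounded (fun x => Normc.normc (Zterm (fun j => (S j).2) Q x)) ->
  (fun N => \sum_(q < N.+1) slot_term (fun j => signed_gf (S j)) (chain_gf weak_step Q) q : C^o)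
    @ \oo --> (Zsigned S Q : C^o).
Proof.
move=> /Z_cvg HZ; rewrite /Zsigned.
rewrite (_ : (fun N => _) = (fun N => (\prod_(j < n) (-1) ^+ (S j).1 : C^o) *
  \sum_(q < N.+1) slot_term (fun j => chain_gf ltn (S j).2) (chain_gf weak_step Q) q : C^o)).
  exact: cvgM (cvg_cst _) HZ.
apply/funext => N; rewrite mulr_sumr; apply: eq_bigr => q _.
exact: slot_term_sgf.
Qed.

End Convergence.

(** * Vanishing of the boundary term *)

Section Boundary.
Variable R : realType.
Local Notation C := R[i].
Local Notation h := (harm C).

(** The square avoids roots: linear growth of [harm ^+ (D * 2)] bounds the square of the boundary
    term by a multiple of [1/N]. *)
Lemma cvg0_sqr_le (b : nat -> C) (c : C) : 0 <= c ->
  (forall N, `|b N| ^+ 2 <= c / N.+1%:R) -> (b : nat -> C^o) @ \oo --> (0 : C^o).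
Proof.
move=> c0 Hb; apply/cvgrPdist_lt => /= e e0.
have er : complex.Re e > 0 by move: e0; rewrite ltcE => /andP[].
have eE : e = (complex.Re e)%:C by rewrite RRe_real // gtr0_real.
have cE : c = (complex.Re c)%:C by rewrite RRe_real // ger0_real.
have c1 : 0 < complex.Re c + 1.
  by rewrite ltr_wpDl //; move: c0; rewrite lecE => /andP[].
have d0 : 0 < (complex.Re e) ^+ 2 / (complex.Re c + 1).
  by rewrite divr_gt0 ?exprn_gt0.
near=> N.
rewrite sub0r normrN -(ltr_pXn2r (n := 2)) ?nnegrE ?(ltW e0) //.
apply: le_lt_trans (Hb N) _.
rewrite eE cE ltr_pdivrMr ?ltr0n // -[N.+1%:R](rmorph_nat (real_complex R)) -rmorphXn -rmorphM /= ltcR.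
apply: (@lt_trans _ _ (complex.Re c + 1)); first by rewrite ltrDl.
have : N.+1%:R^-1 < (complex.Re e) ^+ 2 / (complex.Re c + 1).
  near: N; exact: (near_infty_natSinv_lt (PosNum d0)).
by rewrite ltr_pdivlMr // mulrC ltr_pdivrMr ?ltr0n.
Unshelve. all: by end_near.
Qed.

(** In degree [N + 1] the convolution bound is of order [N!/(N + 1)] up to harmonic powers; the
    division by [N!] leaves [1/(N + 1)]. *)
Lemma boundary_cvg0 n (F : 'I_n -> nat -> C) (G : nat -> C) (v : C) K :
  (2 <= n)%N -> (forall j, F j 0%N = 0) ->
  (forall j a, a%:R * `|F j a| <= h a ^+ K) ->
  (forall q, q%:R * `|G q| <= h q ^+ K) ->
  ((fun N => v * slot_coef F N.+1 * (N%:R * G N) / N`!%:R) : nat -> C^o) @ \oo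
    --> (0 : C^o).
Proof.
move=> n2 F0 FK GK.
pose c : C := `|v| * (6 ^ n.-1)%N%:R; pose D := (K * n + K)%N.
have c0 : 0 <= c by rewrite mulr_ge0 ?ler0n.
have bN N : `|v * slot_coef F N.+1 * (N%:R * G N) / N`!%:R| <=
    c * (h N.+1 ^+ D / N.+1%:R).
  have sc := @slot_coef_le2 R n predT F K N.+1.
  rewrite (eq_card (B := 'I_n)) // card_ord /= in sc.
  have {}sc := sc n2 (fun j _ => F0 j) (fun j _ => FK j) (fun j H => ltac:(by [])).
  have Nf : N`!%:R != 0 :> C by rewrite pnatr_eq0 -lt0n fact_gt0.
  rewrite !normrM normfV !normr_nat ler_pdivrMr ?ltr0n ?fact_gt0 //.
  apply: (@le_trans _ _ (`|v| * ((6 ^ n.-1)%N%:R * h N.+1 ^+ (K * n) *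
     (N`!%:R / N.+1%:R)) * h N.+1 ^+ K)).
    apply: ler_pM; rewrite ?mulr_ge0 ?ler0n // ?ler_wpM2l //.
    exact: le_trans (GK N) (le_harmX _ (leqnn K) (leqnSn N)).
  rewrite le_eqVlt; apply/orP; left; apply/eqP.
  by rewrite /c /D exprD; ring.
have [M M0 HM] := harmX_le C (D * 2).
(* The factor 2 absorbs [N + 2 <= 2 (N + 1)]. *)
apply: (@cvg0_sqr_le _ (c ^+ 2 * (M * 2%:R))) => [|N].
  by rewrite !mulr_ge0 ?exprn_ge0 ?ler0n.
apply: (@le_trans _ _ ((c * (h N.+1 ^+ D / N.+1%:R)) ^+ 2)).
  by rewrite lerXn2r ?nnegrE // mulr_ge0 ?divr_ge0 ?exprn_ge0 ?harm_ge0 ?ler0n.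
rewrite exprMn -mulrA ler_wpM2l ?exprn_ge0 // exprMn -exprM exprVn.
rewrite ler_pdivrMr ?exprn_gt0 ?ltr0n //; apply: le_trans (HM N.+1) _.
rewrite expr2 mulrA divfK ?pnatr_eq0 // -mulrA ler_wpM2l // -natrM ler_nat; lia.
Qed.
End Boundary.

(** * Absolute convergence of every term, then the limit of the telescoped sums *)

Theorem theorem1p2 (R : realType) (n : nat) (hn : (2 <= n)%N)
    (P : 'I_n.+1 -> array R) (hP : forall i, is_array (P i))
    (v : 'I_n -> option R[i])
    (hv : forall j c, v j = Some c -> in_disk c /\ c <> 0)
    (vlast : R[i]) (hvlast : in_disk vlast)
    (hsum : \sum_(j < n) inv_ext (v j) = vlast)
    (h1 : forall j : 'I_n, P (widen_ord (leqnSn n) j) = [::] -> v j <> None)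
    (h2 : n = 2%N ->
      forall j j' : 'I_n, j != j' -> P (widen_ord (leqnSn n) j) = [::] ->
      (forall c, v j' = Some c -> `|c| <> 1) \/ `|vlast| < 1) :
  (forall i : 'I_n.+1,
     Zconverges (lower_slots P v i) (upper_slot P vlast i)) /\
  \sum_(i < n.+1) Zsigned (lower_slots P v i) (upper_slot P vlast i) = 0.
Proof.
pose wd := @widen_ord n n.+1 (leqnSn n).
have a_up (S : array R) : is_array S -> is_array (up S).
  case/lastP: S => [//|S c]; rewrite up_rcons !is_array_rcons.
  by move=> /and3P[-> _ ->].
have a_arrow c (S : array R) : in_disk c -> is_array S -> is_array (arrow c S).
  move=> c1 aS; rewrite /arrow; case: ifP => _; first exact: a_up.
  by rewrite is_array_rcons aS /= andbT.
have a_sarrow j : is_array (sarrow (v j) (P (wd j))).2.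
  case vj: (v j) => [c|] /=; last exact/a_up/hP.
  by apply: a_arrow => //; case: (hv _ _ vj).
(* An infinite arrow acts by [up], which leaves an empty array empty; condition (1) rules this
   out. *)
have n_sarrow j : (sarrow (v j) (P (wd j))).2 <> [::].
  case vj: (v j) => [c|] /=.
    rewrite /arrow; case: eqP => [c0|_]; first by case: (hv _ _ vj).
    by rewrite /push; case: (P _).
  have := @h1 j; rewrite -/wd; case/lastP: (P (wd j)) => [/(_ erefl)//|S c _].
  by rewrite up_rcons; case: S.
have a_lower i j : is_array (lower_slots P v i j).2.
  by rewrite /lower_slots; case: ifP => _ //=; apply: a_sarrow.
have a_upper i : is_array (upper_slot P vlast i).
  by rewrite /upper_slot; case: ifP => _ //; apply: a_arrow.
have bounded i : sum_bounded (fun x => Normc.normc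
    (Zterm (fun j => (lower_slots P v i j).2) (upper_slot P vlast i) x)).
  (* Only the slot without arrow can be empty. If none is, or if [n > 2], two slots are nonempty; in
     the remaining case [n = 2] the decay has to come from condition (2). *)
  case: (pselect (exists j0, (lower_slots P v i j0).2 = [::])); last first.
    move=> nE; apply: Zterm_sum_bounded2 => //.
    rewrite (eq_card (B := predT)) ?card_ord // => j; rewrite !inE.
    by apply/nilP => Ej; apply: nE; exists j.
  move=> [j0 Ej0].
  have [ij0 Pj0] : wd j0 = i /\ P (wd j0) = [::].
    move: Ej0; rewrite /lower_slots -/(wd j0); case: eqP => [e|_] /=; first by [].
    by move=> /n_sarrow.
  have lowj j : j != j0 -> lower_slots P v i j = sarrow (v j) (P (wd j)).
    rewrite /lower_slots -/(wd j) -ij0 => jj0.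
    by rewrite ifF //; apply/negbTE; apply: contra jj0 => /eqP[] /val_inj ->.
  have iN : i != ord_max.
    by rewrite -ij0 -val_eqE /= neq_ltn ltn_ord.
  have [n3|n3] := ltnP 2 n.
    apply: Zterm_sum_bounded2 => //.
    rewrite (eq_card (B := predC1 j0)) ?cardC1 ?card_ord; first by case: (n) n3.
    move=> j; rewrite !inE; case: (j =P j0) => [->|/eqP jj0]; first by rewrite Ej0.
    by rewrite lowj //; apply/nilP; apply: n_sarrow.
  have n_2 : n = 2%N by apply/eqP; rewrite eqn_leq hn n3.
  have [j1 j10] : exists j1, j1 != j0.
    apply/existsP; rewrite -[X in is_true X]negbK negb_exists.
    apply/negP => /forallP H.
    have : (#|predC1 j0| = 0)%N by apply: eq_card0 => j; rewrite !inE; apply/negbTE.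
    by rewrite cardC1 card_ord n_2.
  apply: (@Zterm_sum_bounded1 _ _ _ _ j1) => // [j jj1|].
    have -> // : j = j0.
    apply: val_inj => /=; move: jj1 j10 (ltn_ord j) (ltn_ord j0) (ltn_ord j1).
    by rewrite -!val_eqE /=; move: n3; clear; lia.
  rewrite lowj // /upper_slot (negbTE iN).
  have j01 : j0 != j1 by rewrite eq_sym.
  (* Either the array right of the bar decays, or the only nonempty slot does, its arrow being
     infinite or of modulus below 1. *)
  case: (h2 n_2 j0 j1 j01 Pj0) => [v1|vl1]; last by right; apply: decays_arrow.
  left; case vj: (v j1) => [c|] /=; last by apply: decays_up => //; apply: ltn_weak_step.
  apply: decays_arrow => //; first exact: ltn_weak_step.
  have [c1 _] := hv _ _ vj; rewrite lt_neqAle; apply/andP; split; last exact: c1.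
  by apply/eqP; apply: v1 vj.
split=> [i|]; first exact/sum_bounded_summable/bounded.
pose f j := chain_gf ltn (P (wd j)); pose F j := signed_gf (sarrow (v j) (P (wd j))).
pose g := chain_gf weak_step (P ord_max); pose G := chain_gf weak_step (arrow vlast (P ord_max)).
pose K := (\sum_j size (sarrow (v j) (P (wd j))).2 + size (arrow vlast (P ord_max)))%N.
have F0 j : F j 0%N = 0 by rewrite /F /signed_gf gf0 ?mulr0 //; apply: ltn_weak_step.
have FK j a : a%:R * `|F j a| <= harm R[i] a ^+ K.
  rewrite /F /signed_gf normrM normrX normrN1 expr1n mul1r.
  apply: mul_gf_le_max => //; first exact: ltn_weak_step.
  by rewrite /K (bigD1 j) //= -addnA leq_addr.
have GK q : q%:R * `|G q| <= harm R[i] q ^+ K.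
  by apply: mul_gf_le_max => //; [exact: a_arrow|rewrite leq_addl].
have fF j a : f j a = inv_ext (v j) * (a.+1%:R * F j a.+1) - a%:R * F j a.
  by apply: sgf_sarrow; [move=> c /hv[]|apply: h1].
have gG q : q.+1%:R * G q.+1 =
    (\sum_j inv_ext (v j)) * (q%:R * G q + (q == 0%N)%:R * g 0%N) + g q.+1.
  by rewrite hsum; apply: gf_arrow_weak.
have tel := telescope_slots hn F0 fF gG.
pose T i N : R[i]^o := \sum_(q < N.+1)
  slot_term (fun j => signed_gf (lower_slots P v i j)) (chain_gf weak_step (upper_slot P vlast i)) q.
have HT i : T i @ \oo --> (Zsigned (lower_slots P v i) (upper_slot P vlast i) : R[i]^o).
  exact: Zsigned_cvg (bounded i).
have sumT N : \sum_i T i N =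
    (\sum_j inv_ext (v j)) * slot_coef F N.+1 * (N%:R * G N) / N`!%:R.
  (* The split isolates the term [i = n], in which every slot left of the bar carries its arrow and
     [g] replaces [G]. *)
  rewrite -tel big_ord_recr /=; congr (_ + _).
    apply: eq_bigr => j _; apply: eq_bigr => q _; rewrite /slot_term /upper_slot.
    rewrite -/(wd j) ifF; last by rewrite -val_eqE /= ltn_eqF.
    congr (_ * (_ * _)); congr slot_coef; apply/funext => k; apply/funext => a.
    rewrite /lower_slots /swap_slot -/(wd k) -!val_eqE /=; case: ifP => // _.
    by rewrite /signed_gf mul1r.
  apply: eq_bigr => q _; rewrite /slot_term /upper_slot eqxx.
  congr (_ * (_ * _)); congr slot_coef; apply/funext => k.
  by rewrite /lower_slots -/(wd k) ifF // -val_eqE /= ltn_eqF.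
have C1 : (fun N => \sum_i T i N) @ \oo -->
    (\sum_i Zsigned (lower_slots P v i) (upper_slot P vlast i) : R[i]^o).
  by apply: cvg_big => //; exact: pseudometric_normed_Zmodule.add_continuous.
have C0 : (fun N => \sum_i T i N) @ \oo --> (0 : R[i]^o).
  by rewrite (funext sumT); apply: boundary_cvg0 FK GK.
exact: norm_cvg_unique C1 C0.
Qed.
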